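(* Let $\lambda$ and $\mu$ be decompositions of $n+1$. The groups $P_{\lambda|\mu}$ and $\left\langle A_{2,n}(S_{\lambda|\mu})\right\rangle$ are isomorphic.
   Context: A two-dimensional Coxeter system is a triple $(X,f,g)$ with $f\colon \binom{X}{2}\to\mathbb{N}$ and $g\colon\binom{X}{3}\to\mathbb{N}$ (viewed as symmetric functions on $X^2$, $X^3$). The associated group $\langle X,f,g\rangle$ is generated by $X$ subject to the relations $x^2=e$, $(xy)^{f(x,y)}=e$, $(xyz)^{g(x,y,z)}=e$ for $x,y,z\in X$ (a value $0$ imposes no relation). For a subset $S\subseteq X$, $(X,f,g)(S)$ denotes the system obtained by restricting $f$ and $g$ to $S$. The system $A_{2,n}$ has $X=\{x_1,\dots,x_n,y_1,\dots,y_n\}$, with $f(x_i,x_{i+1})=f(y_i,y_{i+1})=4$ for $1\le i\le n-1$, $f(x_i,y_i)=3$ for $1\le i\le n$, and $f=2$ on all other pairs; and $g(x_i,x_{i+1},y_i)=g(x_i,x_{i+1},y_{i+1})=g(x_i,y_i,y_{i+1})=g(x_{i+1},y_i,y_{i+1})=3$ for $1\le i\le n-1$, $g(x_i,x_{i+1},x_{i+2})=g(y_i,y_{i+1},y_{i+2})=4$ for $1\le i\le n-2$, and $g=0$ on all other triples. For a decomposition $\lambda=(\lambda_1,\dots,\lambda_l)$ of $n+1$ into non-zero parts, $P_\lambda$ is the standard parabolic subgroup of $\mathrm{GL}_{n+1}(\mathbb{F}_2)$ of block upper-triangular matrices with diagonal blocks in $\mathrm{GL}_{\lambda_1}(\mathbb{F}_2),\dots,\mathrm{GL}_{\lambda_l}(\mathbb{F}_2)$,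 and $P_{\lambda|\mu}=P_\lambda\cap P_\mu^t$ (where $P_\mu^t$ is the group of transposes of elements of $P_\mu$). The set of stopovers is $\overline{s}(\lambda)=\{\lambda_1,\lambda_1+\lambda_2,\dots,\lambda_1+\dots+\lambda_{l-1}\}$, and $S_{\lambda|\mu}=\{x_i : i\notin\overline{s}(\lambda)\}\cup\{y_j : j\notin\overline{s}(\mu)\}\subseteq X$. *)

(* Defs.v *)
From HB Require Import structures.
From mathcomp Require Import all_boot all_order all_algebra all_fingroup.
Set Implicit Arguments.
Unset Strict Implicit.
Unset Printing Implicit Defensive.
Import GRing.Theory.

(* A word is a sequence of letters (a, true) = a, (a, false) = a^-1.   *)
(* [pres_eq R u v] is the congruence on words defining the group       *)
(* F(A) / N(R): generated by free cancellation and insertion/deletion  *)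
(* of relators anywhere in a word.                                     *)

Definition letter (A : Type) := (A * bool)%type.

Inductive pres_eq (A : Type) (R : seq (letter A) -> Prop) :
    seq (letter A) -> seq (letter A) -> Prop :=
| pe_refl w : pres_eq R w w
| pe_sym u v : pres_eq R u v -> pres_eq R v u
| pe_trans u v w : pres_eq R u v -> pres_eq R v w -> pres_eq R u w
| pe_cancel u v a b : pres_eq R (u ++ [:: (a, b); (a, ~~ b)] ++ v) (u ++ v)
| pe_rel u v r : R r -> pres_eq R (u ++ r ++ v) (u ++ v).

Definition eval_word (A : Type) (G : finGroupType) (psi : A -> G)
    (w : seq (letter A)) : G :=
  foldr (fun l acc => ((if l.2 then psi l.1 else (psi l.1)^-1) * acc)%g) 1%g w.

(* The presented group <A | R> is isomorphic to the subset H of G:     *)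
(* there is an assignment of generators psi such that the induced map  *)
(* words -> G has image exactly H and identifies exactly the words     *)
(* that are equal in <A | R> (i.e. [w] |-> eval_word psi w is a        *)
(* well-defined injective homomorphism from <A|R> onto H).             *)
Definition pres_isom (A : Type) (R : seq (letter A) -> Prop)
    (G : finGroupType) (H : {set G}) : Prop :=
  exists psi : A -> G,
    [/\ forall w, eval_word psi w \in H,
        forall h, h \in H -> exists w, eval_word psi w = h
      & forall u v, eval_word psi u = eval_word psi v <-> pres_eq R u v].

(* f, g are given as (symmetric) functions on X^2, X^3; only their     *)
(* values on pairs / triples of distinct elements are used.            *)

Record cox2 := Cox2 {
  cox_X : eqType;
  cox_f : cox_X -> cox_X -> nat;
  cox_g : cox_X -> cox_X -> cox_X -> nat }.

(* an exponent 0 yields the empty relator, i.e. no relation.           *)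
Definition cox_rel (C : cox2) (r : seq (letter (cox_X C))) : Prop :=
  (exists x, r = [:: (x, true); (x, true)]) \/
  (exists x y, x != y /\
     r = flatten (nseq (cox_f x y) [:: (x, true); (y, true)])) \/
  (exists x y z, [/\ x != y, y != z & x != z] /\
     r = flatten (nseq (cox_g x y z) [:: (x, true); (y, true); (z, true)])).

Definition cox_restr (C : cox2) (S : pred (cox_X C)) : cox2 :=
  @Cox2 {x : cox_X C | S x}
        (fun x y => cox_f (val x) (val y))
        (fun x y z => cox_g (val x) (val y) (val z)).

Arguments cox_restr : clear implicits.

Definition cox_group_isom (C : cox2) (G : finGroupType) (H : {set G}) :=
  pres_isom (@cox_rel C) H.

(* The system A_{2,n}.  Generators: (i, false) = x_{i+1},              *)
(* (i, true) = y_{i+1}, for i : 'I_n (0-based index).                  *)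

Definition A2gen (n : nat) := ('I_n * bool)%type.

Definition gkey (n : nat) (p : A2gen n) : nat * bool := (val p.1, p.2).

Definition A2_f (n : nat) (p q : A2gen n) : nat :=
  let K := [:: gkey p; gkey q] in
  if [exists i : 'I_n, (i.+1 < n) &&
        (perm_eq K [:: (val i, false); (i.+1, false)] ||
         perm_eq K [:: (val i, true); (i.+1, true)])] then 4
  else if [exists i : 'I_n, perm_eq K [:: (val i, false); (val i, true)]] then 3
  else 2.

Definition A2_g (n : nat) (p q r : A2gen n) : nat :=
  let K := [:: gkey p; gkey q; gkey r] in
  if [exists i : 'I_n, (i.+1 < n) &&
        [|| perm_eq K [:: (val i, false); (i.+1, false); (val i, true)],
            perm_eq K [:: (val i, false); (i.+1, false); (i.+1, true)],
            perm_eq K [:: (val i, false); (val i, true); (i.+1, true)] |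
            perm_eq K [:: (i.+1, false); (val i, true); (i.+1, true)]]] then 3
  else if [exists i : 'I_n, (i.+2 < n) &&
        (perm_eq K [:: (val i, false); (i.+1, false); (i.+2, false)] ||
         perm_eq K [:: (val i, true); (i.+1, true); (i.+2, true)])] then 4
  else 0.

Definition A2 (n : nat) : cox2 :=
  @Cox2 (A2gen n : eqType) (@A2_f n) (@A2_g n).

Definition decomposition (m : nat) (lam : seq nat) : bool :=
  all (fun a => 0 < a) lam && (sumn lam == m).

Definition stopovers (lam : seq nat) : seq nat :=
  [seq sumn (take k lam) | k <- iota 1 (size lam).-1].

(* S_{lam|mu} = {x_i : i notin s(lam)} U {y_j : j notin s(mu)}, 1-based *)
Definition S_lm (n : nat) (lam mu : seq nat) : pred (A2gen n) :=
  fun p => if p.2 then (val p.1).+1 \notin stopovers mu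
           else (val p.1).+1 \notin stopovers lam.

Notation GL2 n := {'GL_n.+1['F_2]}.

(* block index (0-based) of the 0-based row/column index i *)
Definition blk (lam : seq nat) (i : nat) : nat :=
  count (fun s => s <= i) (stopovers lam).

Definition Pblock (n : nat) (lam : seq nat) : {set GL2 n} :=
  [set A : GL2 n |
     [forall i : 'I_n.+1, forall j : 'I_n.+1,
        (blk lam j < blk lam i) ==> (GLval A i j == 0%R)] &&
     [forall k : 'I_(size lam),
        ((\matrix_(i < nth 0 lam k, j < nth 0 lam k)
            GLval A (inord (sumn (take k lam) + i))
                    (inord (sumn (take k lam) + j)))%R \in unitmx)]].

Definition Pblock_t (n : nat) (mu : seq nat) : {set GL2 n} :=
  [set A : GL2 n | [exists B in Pblock n mu, GLval A == (GLval B)^T%R]].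

Definition Plm (n : nat) (lam mu : seq nat) : {set GL2 n} :=
  Pblock n lam :&: Pblock_t n mu.

Arguments S_lm : clear implicits.
Arguments Pblock : clear implicits.
Arguments Pblock_t : clear implicits.
Arguments Plm : clear implicits.

(* Main.v *)
Require Import Defs.
From mathcomp Require Import all_boot all_algebra all_fingroup.
From HB Require Import structures.
From mathcomp Require Import zify boolp.

(* With 0-based indices, the paper's y_{i+1} and x_{i+1} correspond to the
   transvections 1 + E_{i,i+1} and 1 + E_{i+1,i}; call u_i and l_i the matching
   elements of a group G in which the Coxeter relations hold.  P_{lambda|mu} is the
   unit group of the incidence algebra of the preorder on {0,..,n} generated by the
   available transvections, and it suffices to extend the assignment of the u_i, l_i
   to a homomorphism phi : P_{lambda|mu} -> G: for G the presented group this yields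
   injectivity.  Let P_k be the subgroup generated by the transvections of index < k;
   phi is extended from P_k to P_{k+1} as follows.
   - The available vectors v for column k+1 form a P_k-module V, and psi : V -> G is
     forced: psi(e_k) = u_k, and psi(a) = [phi(1 + a e_k^T), u_k] when a_k = 0.  The
     relations of order 4 make psi additive, and (u_{k-1} u_k l_{k-1})^3 = 1 makes it
     equivariant under l_{k-1}.  Row k+1 gives rho by inverse transposition.
   - If q v = 0 then rho(q) psi(v) = psi(v) phi(1 + v q) rho(q): this is the relation
     (l_{k-1} l_k u_k)^3 = 1, and its transpose, spread over all q and v.
   - A matrix of P_{k+1} is either U(v) B L(r), or L(q) U(v) B L(r) with q v = 1,
     where B is in P_k and U(v), L(r) are the transvections filling column and row
     k+1.  Its image is psi(v) phi(B) rho(r), resp. rho(q) psi(v) phi(B) rho(r).  The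
     commutation rule makes this independent of q and, together with
     (u_k l_k)^3 = 1, compatible with left multiplication by the generators. *)

Set Implicit Arguments.
Unset Strict Implicit.
Unset Printing Implicit Defensive.
Import GRing.Theory.

(** * Transvections and incidence groups over F_2 *)

Section Matrices.
Local Open Scope ring_scope.
Variable n : nat.
Notation M := 'M['F_2]_n.+1.
Notation cV := 'cV['F_2]_n.+1.
Notation rV := 'rV['F_2]_n.+1.
Implicit Types (A B : M) (u v w : cV) (q r : rV) (T : nat -> bool).

Lemma F2P (a : 'F_2) : a = 0 \/ a = 1.
Proof. by case: a => [[|[|m]] i] //; [left|right]; apply/val_inj. Qed.

Lemma F2_neq0 (a : 'F_2) : a != 0 -> a = 1.
Proof. by case: (F2P a) => -> //; rewrite eqxx. Qed.

Lemma addmm m p (A : 'M['F_2]_(m, p)) : A + A = 0.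
Proof. by apply/matrixP=> i j; rewrite !mxE; case: (F2P (A i j)) => ->; apply/val_inj. Qed.

Lemma addmKl m p (A B : 'M['F_2]_(m, p)) : A + (A + B) = B.
Proof. by rewrite addrA addmm add0r. Qed.

Lemma addmKr m p (A B : 'M['F_2]_(m, p)) : B + A + A = B.
Proof. by rewrite -addrA addmm addr0. Qed.

Lemma addm_eq0 m p (A B : 'M['F_2]_(m, p)) : A + B = 0 -> A = B.
Proof. by move=> AB0; rewrite -[A](addmKr B) AB0 add0r. Qed.

Lemma mx1P (a : 'M['F_2]_1) : a = 0 \/ a = 1%:M.
Proof.
case: (F2P (a 0 0)) => a00; [left|right]; apply/matrixP => i j;
by rewrite !ord1 a00 !mxE.
Qed.

Lemma mx1_neq01 : (1%:M : 'M['F_2]_1) <> 0.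
Proof. by move/matrixP/(_ 0 0)/eqP; rewrite !mxE. Qed.

Definition ecol (k : nat) : cV := \col_i (i == k :> nat)%:R.
Definition erow (k : nat) : rV := (ecol k)^T.

Lemma erow_mulE k v : (k <= n)%N -> erow k *m v = (v (inord k) 0)%:M.
Proof.
move=> kn; apply/matrixP=> i j; rewrite !ord1 !mxE (bigD1 (inord k)) //=.
rewrite !mxE inordK ?ltnS // eqxx mul1r big1 ?addr0 // => l lk.
rewrite !mxE; case: eqP => [lE|]; last by rewrite mul0r.
by case/eqP: lk; apply/val_inj; rewrite /= inordK ?ltnS // lE.
Qed.

Lemma erow_ecol k : (k <= n)%N -> erow k *m ecol k = 1%:M.
Proof. by move=> kn; rewrite erow_mulE // mxE inordK ?ltnS // eqxx. Qed.

Lemma erow_ecol0 k l : k <> l -> erow k *m ecol l = 0.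
Proof.
move=> kl; apply/matrixP=> i j; rewrite !mxE big1 // => m _; rewrite !mxE.
by case: eqP => [->|]; rewrite ?mul0r //; case: eqP => // _; rewrite mulr0.
Qed.

Definition transv u q : M := 1%:M + u *m q.

Lemma transv0l q : transv 0 q = 1%:M. Proof. by rewrite /transv mul0mx addr0. Qed.
Lemma transv0r u : transv u 0 = 1%:M. Proof. by rewrite /transv mulmx0 addr0. Qed.

Lemma transv_mulv u q w : transv u q *m w = w + u *m (q *m w).
Proof. by rewrite /transv mulmxDl mul1mx mulmxA. Qed.

Lemma mul_transvr u q r : r *m transv u q = r + r *m u *m q.
Proof. by rewrite /transv mulmxDr mulmx1 mulmxA. Qed.

Lemma transv_fixv u q w : q *m w = 0 -> transv u q *m w = w.
Proof. by move=> qw; rewrite transv_mulv qw mulmx0 addr0. Qed.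

Lemma transv_fixr u q r : r *m u = 0 -> r *m transv u q = r.
Proof. by move=> ru; rewrite mul_transvr ru mul0mx addr0. Qed.

Lemma transvDl u v q : q *m v = 0 -> transv u q *m transv v q = transv (u + v) q.
Proof.
move=> qv; rewrite /transv mulmxDr mulmx1 mulmxDl mul1mx -mulmxA (mulmxA q) qv.
by rewrite mul0mx mulmx0 addr0 -addrA mulmxDl.
Qed.

Lemma transvDr u q r : q *m u = 0 -> transv u q *m transv u r = transv u (q + r).
Proof.
move=> qu; rewrite /transv mulmxDr mulmx1 mulmxDl mul1mx -mulmxA (mulmxA q) qu.
by rewrite mul0mx mulmx0 addr0 -addrA mulmxDr.
Qed.

Lemma transv_conj A u q : A \in unitmx -> A *m transv u q = transv (A *m u) (q *m invmx A) *m A.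
Proof.
move=> Au; rewrite /transv mulmxDl mulmxDr mulmx1 mul1mx -!mulmxA mulVmx //.
by rewrite mulmx1.
Qed.

Lemma transv_inv u q : q *m u = 0 -> transv u q *m transv u q = 1%:M.
Proof. by move=> qu; rewrite transvDl // addmm transv0l. Qed.

Lemma transv_unit u q : q *m u = 0 -> transv u q \in unitmx.
Proof. by move=> qu; case: (mulmx1_unit (transv_inv qu)). Qed.

Lemma transv_tr u q : (transv u q)^T = transv q^T u^T.
Proof. by rewrite /transv linearD /= trmx1 trmx_mul. Qed.

Lemma erow_tr k : (erow k)^T = ecol k. Proof. by rewrite /erow trmxK. Qed.
Lemma ecol_tr k : (ecol k)^T = erow k. Proof. by []. Qed.

(* Vectors that may fill column [k] above the diagonal: an index [j] in the support
   must reach [k] through the steps [t -> t+1] allowed by [T]. *)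
Definition colsupp T (k : nat) v :=
  forall j, v j 0 != 0 -> (j < k)%N /\ forall t, (j <= t < k)%N -> T t.

Lemma colsupp0 T k : colsupp T k 0.
Proof. by move=> j; rewrite mxE eqxx. Qed.

Lemma colsuppD T k v w : colsupp T k v -> colsupp T k w -> colsupp T k (v + w).
Proof.
move=> sv sw j; rewrite mxE; case: (eqVneq (v j 0) 0) => [->|vj _].
  by rewrite add0r; apply: sw.
exact: sv.
Qed.

Lemma colsupp_ecol T k : T k -> colsupp T k.+1 (ecol k).
Proof.
move=> Tk j; rewrite mxE; case: (eqVneq (j : nat) k) => [->|_]; last by rewrite eqxx.
move=> _; split=> [|t]; rewrite ?ltnSn //; case: (ltngtP t k) => [||->]; lia.
Qed.

Lemma colsupp_erow0 T k l v : colsupp T k v -> (k <= l)%N -> erow l *m v = 0.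
Proof.
move=> sv kl; apply/matrixP=> i j; rewrite !mxE big1 // => m _; rewrite !mxE ord1.
case: (eqVneq (v m 0) 0) => [->|/sv [mk _]]; rewrite ?mulr0 //.
by case: eqP => [ml|]; rewrite ?mul0r //; lia.
Qed.

Lemma colsuppW (T : nat -> bool) k v : T k -> colsupp T k v -> colsupp T k.+1 v.
Proof.
move=> Tk sv j /sv [jk Tj]; split=> [|t]; first exact: ltnW.
rewrite ltnS [(t <= k)%N]leq_eqVlt => /andP[jt /orP[/eqP->//|tk]].
by apply: Tj; rewrite jt.
Qed.

Lemma colsuppS T k v : (k <= n)%N -> colsupp T k.+1 v ->
  exists2 a, colsupp T k a & v = a \/ T k /\ v = a + ecol k.
Proof.
move=> kn sv; case: (eqVneq (v (inord k) 0) 0) => vk.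
  exists v; last by left.
  move=> j vj; have [jk Tj] := sv j vj.
  have jk' : (j : nat) != k.
    by apply: contra_neq vj => jE; rewrite -jE inord_val in vk.
  have {}jk : (j < k)%N by lia.
  by split=> // t tj; apply: Tj; lia.
have Tk : T k.
  have [_ Tj] := sv _ vk.
  by apply: Tj; rewrite inordK ?ltnS // leqnn /=.
exists (v + ecol k); last by right; rewrite addmKr.
move=> j; rewrite !mxE; case: (eqVneq (j : nat) k) => jk.
  have -> : j = inord k by apply/val_inj; rewrite /= inordK.
  by rewrite (F2_neq0 vk) /=.
rewrite addr0 => vj; have [jk' Tj] := sv j vj.
have {}jk : (j < k)%N by lia.
by split=> // t tj; apply: Tj; lia.
Qed.

Variable (S : bool -> nat -> bool).

(** This is the preorder generated by the allowed steps of index below [k]. At most one of the two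
    clauses is non-vacuous, since a shortest path between two indices is monotone. *)
Definition reach (k i j : nat) :=
  (forall t, (i <= t < j)%N -> S true t /\ (t < k)%N) /\
  (forall t, (j <= t < i)%N -> S false t /\ (t < k)%N).

Lemma reach_refl k i : reach k i i.
Proof. by split=> t /andP[it ti]; lia. Qed.

Lemma reach_trans k i j l : reach k i j -> reach k j l -> reach k i l.
Proof.
move=> [ij ji] [jl lj]; split=> t /andP[t1 t2]; case: (leqP j t) => jt.
- by apply: jl; rewrite jt.
- by apply: ij; rewrite t1.
- by apply: ji; rewrite jt.
- by apply: lj; rewrite t1.
Qed.

(** The incidence algebra over F_2 of the preorder [reach k]; its unit group [inc_group] is the
    group P_k of the overview. *)
Definition incid k A := forall i j, A i j != 0 -> reach k i j.
Definition inc_group k A := A \in unitmx /\ incid k A.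

Lemma incid1 k : incid k 1%:M.
Proof.
move=> i j; rewrite mxE; case: (eqVneq i j) => [-> _|]; last by rewrite eqxx.
exact: reach_refl.
Qed.

Lemma inc_group1 k : inc_group k 1%:M.
Proof. by split; [exact: unitmx1 | exact: incid1]. Qed.

Lemma sum_neq0 (I : finType) (F : I -> 'F_2) : \sum_i F i != 0 -> exists i, F i != 0.
Proof.
move=> sF; apply/existsP; apply: contraNT sF; rewrite negb_exists => /forallP F0.
by rewrite big1 // => i _; apply/eqP; move: (F0 i); rewrite negbK.
Qed.

Lemma incidM k A B : incid k A -> incid k B -> incid k (A *m B).
Proof.
move=> iA iB i l; rewrite mxE => /sum_neq0[j]; rewrite mulf_eq0 negb_or => /andP[/iA ij /iB jl].
exact: reach_trans ij jl.
Qed.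

Lemma inc_groupM k A B : inc_group k A -> inc_group k B -> inc_group k (A *m B).
Proof. by move=> [uA iA] [uB iB]; split; [rewrite unitmx_mul uA | exact: incidM]. Qed.

(** In a finite group the inverse of an element is one of its powers, and the incidence algebra is
    closed under products. *)
Lemma inc_groupV k A : inc_group k A -> inc_group k (invmx A).
Proof.
move=> [uA iA]; split; first by rewrite unitmx_inv.
have uA' : A \is a GRing.unit by [].
have E : invmx A = A ^+ (#[FinRing.unit 'M['F_2]_n.+1 uA'])%g.-1.
  have: ((FinRing.unit 'M['F_2]_n.+1 uA')^-1)%g =
        ((FinRing.unit 'M['F_2]_n.+1 uA') ^+ (#[FinRing.unit 'M['F_2]_n.+1 uA']).-1)%g.
    by rewrite -invg_expg.
  by move/(congr1 val); rewrite FinRing.val_unitX.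
rewrite E; elim: _.-1 => [|m IH]; first by rewrite expr0; exact: incid1.
by rewrite exprS; apply: incidM.
Qed.

(** An index of the new support reaches an old one, and from there k+1. Hence the vectors available
    for column k+1 form a P_k-module. *)
Lemma colsupp_mul k A v : inc_group k A -> colsupp (S true) k.+1 v ->
  colsupp (S true) k.+1 (A *m v).
Proof.
move=> [_ iA] sv i; rewrite mxE => /sum_neq0[j]; rewrite mulf_eq0 negb_or.
case/andP=> [/iA [ij ji] /sv [jk Tj]]; split=> [|t /andP[it tk]].
  rewrite ltnNge; apply/negP => ki.
  by have [] := ji k; [rewrite -ltnS jk | rewrite ltnn].
case: (leqP j t) => jt; first by apply: Tj; rewrite jt.
by case: (ij t); rewrite ?it.
Qed.

Lemma inc_group_transv k v q : colsupp (S true) k.+1 v -> colsupp (S false) k.+1 q^T -> q *m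
  v = 0 ->
  inc_group k (transv v q).
Proof.
move=> sv sq qv; split; first exact: transv_unit.
move=> i j; rewrite mxE; case: (eqVneq i j) => [->|ij]; first by move=> _; exact: reach_refl.
rewrite mxE (negbTE ij) add0r mxE big_ord1 mulf_eq0 negb_or => /andP[/sv [ik Ti]].
have -> : q 0 j = q^T j 0 by rewrite mxE.
move=> /sq [jk Tj]; split=> t /andP[t1 t2].
  by split; [apply: Ti; lia | lia].
by split; [apply: Tj; lia | lia].
Qed.

Lemma inc_group_transv_col k v : colsupp (S true) k v -> inc_group k (transv v (erow k)).
Proof.
move=> sv; split; first by apply: transv_unit; apply: colsupp_erow0 sv _.
move=> i j; rewrite mxE; case: (eqVneq i j) => [->|ij]; first by move=> _; exact: reach_refl.
rewrite mxE (negbTE ij) add0r mxE big_ord1 mulf_eq0 negb_or => /andP[/sv [ik Ti]].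
rewrite !mxE; case: (eqVneq (j : nat) k) => [jk _|_]; last by rewrite eqxx.
by split=> t /andP[t1 t2]; [split; [apply: Ti|]|]; lia.
Qed.

Lemma inc_group_S k A : inc_group k A -> inc_group k.+1 A.
Proof.
move=> [uA iA]; split=> // i j /iA [ij ji].
by split=> t /[dup] tt; [case/ij|case/ji] => St tk; split=> //; exact: ltnW.
Qed.

(** Index [l] is isolated in the preorder [reach k], so column [l] of A is supported on the
    diagonal; being nonzero over F_2, it equals [ecol l]. *)
Lemma inc_group_fixv k A l : inc_group k A -> (k < l)%N -> A *m ecol l = ecol l.
Proof.
move=> [uA iA] kl.
have cz (i : 'I_n.+1) : (i : nat) != l -> (A *m ecol l) i 0 = 0.
  move=> il; apply/eqP; rewrite mxE; apply: contraTT isT => /sum_neq0[j].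
  rewrite mulf_eq0 negb_or mxE => /andP[/iA [ij ji]]; case: (eqVneq (j : nat) l) => [jl _|_];
    last by rewrite eqxx.
  rewrite jl in ij ji; case: (ltngtP i l) => [il'|il'|il']; last by rewrite il' eqxx in il.
    by have [|_] := ij l.-1; lia.
  by have [|_] := ji l; lia.
(* For [l] beyond [n] the vector [ecol l] is zero. *)
case: (leqP l n) => ln; last first.
  have -> : ecol l = 0; last by rewrite mulmx0.
  by apply/matrixP=> i j; rewrite !mxE; case: eqP => // il; have := ltn_ord i; lia.
have ez : A *m ecol l = 0 \/ A *m ecol l = ecol l.
  case: (F2P ((A *m ecol l) (inord l) 0)) => El; [left|right];
  apply/matrixP=> i j; rewrite ord1; case: (eqVneq (i : nat) l) => il.
  - by have -> : i = inord l; [apply/val_inj; rewrite /= inordK | rewrite El mxE].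
  - by rewrite cz // mxE.
  - by have -> : i = inord l; [apply/val_inj; rewrite /= inordK | rewrite El mxE inordK ?eqxx].
  - by rewrite cz // mxE (negbTE il).
case: ez => // ez; have : ecol l = 0 by rewrite -[ecol l](mulKmx uA) ez mulmx0.
move=> e0; have := erow_ecol ln; rewrite e0 mulmx0 => /esym /mx1_neq01 [].
Qed.

(** Without steps the preorder is equality, so A is diagonal, and an invertible diagonal matrix over
    F_2 is the identity. *)
Lemma inc_group_0 A : inc_group 0 A -> A = 1%:M.
Proof.
move=> [uA iA]; suff iE i j : A i j = (i == j)%:R by apply/matrixP=> i j; rewrite iE mxE.
case: (eqVneq i j) => [->|ij].
  apply: F2_neq0; apply: contraTneq uA => Aj.
  have cz : A *m ecol j = 0.
    apply/matrixP=> l m; rewrite !mxE big1 // => s _; rewrite mxE.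
    case: eqP => [/val_inj ->|]; last by rewrite mulr0.
    rewrite mulr1; case: (eqVneq l j) => [->//|lj].
    apply/eqP; apply: contraTT isT => /iA [H1 H2].
    case: (ltngtP l j) => [lj'|lj'|/val_inj lj']; last by rewrite lj' eqxx in lj.
      by have [|_] := H1 l; lia.
    by have [|_] := H2 j; lia.
  apply/negP => uA; have : ecol j = 0 by rewrite -[ecol j](mulKmx uA) cz mulmx0.
  move=> e0; have := @erow_ecol j; rewrite e0 mulmx0 -ltnS ltn_ord => /(_ isT) /esym /mx1_neq01 [].
apply/eqP; apply: contraTT isT => /iA [H1 H2].
case: (ltngtP i j) => [lj'|lj'|/val_inj lj']; last by rewrite lj' eqxx in ij.
  by have [|_] := H1 i; lia.
by have [|_] := H2 j; lia.
Qed.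

End Matrices.

(** * Gaussian elimination and generation of incidence groups by transvections *)

Section Generation.
Local Open Scope ring_scope.
Variable n : nat.
Notation M := 'M['F_2]_n.+1.
Notation cV := 'cV['F_2]_n.+1.
Notation rV := 'rV['F_2]_n.+1.
Notation ecol := (ecol n).
Notation erow := (erow n).
Implicit Types (A B : M) (u v w : cV) (q r : rV) (T : nat -> bool) (S : bool -> nat -> bool).

(** Transposition exchanges the two families of generators; with [swap], statements on rows become
    instances of statements on columns. *)
Definition swap (U : Type) (S : bool -> U) := fun b => S (~~ b).

(* [b = true] is the paper's y_{k+1}, [b = false] its x_{k+1}. *)
Definition gen_mx (b : bool) k : M :=
  if b then transv (ecol k) (erow k.+1) else transv (ecol k.+1) (erow k).

Lemma gen_mx_col k : gen_mx true k = transv (ecol k) (erow k.+1). Proof. by []. Qed.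
Lemma gen_mx_row k : gen_mx false k = transv (ecol k.+1) (erow k). Proof. by []. Qed.

Lemma gen_mx_tr b k : (gen_mx b k)^T = gen_mx (~~ b) k.
Proof. by case: b; rewrite /gen_mx /= transv_tr erow_tr ecol_tr. Qed.

Lemma inc_group_tr S k A : inc_group S k A -> inc_group (swap S) k A^T.
Proof.
move=> [uA iA]; split; first by rewrite unitmx_tr.
by move=> i j; rewrite mxE => /iA [].
Qed.

Lemma inc_group_trV S k A : inc_group (swap S) k A -> inc_group S k A^T.
Proof.
move=> [uA iA]; split; first by rewrite unitmx_tr.
by move=> i j; rewrite mxE => /iA [].
Qed.

Lemma inc_group_transv_row S k q : colsupp (S false) k q^T -> inc_group S k (transv (ecol k) q).
Proof. by move=> sq; rewrite -[transv _ _]trmxK transv_tr;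
  apply/inc_group_trV/inc_group_transv_col. Qed.

Lemma inc_group_fixr S k A l : inc_group S k A -> (k < l)%N -> erow l *m A = erow l.
Proof. by move=> /inc_group_tr PA kl; apply: trmx_inj;
  rewrite trmx_mul erow_tr (inc_group_fixv PA). Qed.

Lemma rowsupp_erow0 T k l q : colsupp T k q^T -> (k <= l)%N -> q *m ecol l = 0.
Proof. by move=> sq kl; apply: trmx_inj; rewrite trmx_mul trmx0 ecol_tr (colsupp_erow0 sq). Qed.

Lemma colsupp_nT T k v : ~~ T k -> colsupp T k.+1 v -> v = 0.
Proof.
move=> nT sv; apply/matrixP=> i j; rewrite ord1 mxE; apply/eqP.
by apply: contraNT nT => /sv [ik Ti]; apply: Ti; lia.
Qed.

Lemma rowsupp_mul S k A q : inc_group S k A -> colsupp (S false) k.+1 q^T ->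
  colsupp (S false) k.+1 (q *m A)^T.
Proof. by move=> /inc_group_tr PA sq; rewrite trmx_mul; apply: (colsupp_mul PA). Qed.

Lemma ecol_mulE A k : (k <= n)%N -> A *m ecol k = col (inord k) A.
Proof.
move=> kn; apply/matrixP=> i j; rewrite !mxE (bigD1 (inord k)) //= mxE.
rewrite inordK ?ltnS // eqxx mulr1 big1 ?addr0 // => l; rewrite mxE.
case: (eqVneq (l : nat) k) => [lk|_]; last by rewrite mulr0.
by rewrite -lk inord_val eqxx.
Qed.

Lemma erow_mul_tr A k : erow k *m (A^T *m ecol k) = (erow k *m (A *m ecol k))^T.
Proof. by rewrite !trmx_mul erow_tr ecol_tr mulmxA. Qed.

Lemma colsupp_col S k A : (k <= n)%N -> incid S k A -> erow k *m (A *m ecol k) = 0 ->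
  colsupp (S true) k (A *m ecol k).
Proof.
move=> kn iA; rewrite erow_mulE // => e0 i Ai.
have ik : (i : nat) != k.
  apply: contraNneq Ai => ik; move/matrixP/(_ 0 0): e0.
  by rewrite -ik inord_val !mxE eqxx mulr1n => ->.
move: Ai; rewrite ecol_mulE // mxE => /iA []; rewrite inordK ?ltnS // => H1 H2.
have {ik} ik : (i < k)%N.
  by case: (ltngtP i k) ik => // ki _; have [|_] := H2 k; lia.
by split=> // t /H1 [].
Qed.

Lemma colsupp_col1 S k A : (k <= n)%N -> incid S k A -> erow k *m (A *m ecol k) = 1%:M ->
  colsupp (S true) k (A *m ecol k + ecol k).
Proof.
move=> kn iA; rewrite erow_mulE // => e0 i.
case: (eqVneq (i : nat) k) => [ik|ik].
  move/matrixP/(_ 0 0): e0.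
  by rewrite -ik inord_val !mxE eqxx mulr1n => ->; rewrite eqxx .
rewrite mxE [ecol k i 0]mxE (negbTE ik) addr0.
rewrite ecol_mulE // mxE => /iA []; rewrite inordK ?ltnS // => H1 H2.
have {ik} ik : (i < k)%N.
  by case: (ltngtP i k) ik => // ki _; have [|_] := H2 k; lia.
by split=> // t /H1 [].
Qed.

(** A monotone path uses the step of index [k] only if it starts or ends at k+1, and the two fixed
    vectors isolate that index. *)
Lemma inc_group_Sinv S k A : (k < n)%N -> inc_group S k.+1 A -> A *m ecol k.+1 = ecol k.+1 ->
  erow k.+1 *m A = erow k.+1 -> inc_group S k A.
Proof.
move=> kn [uA iA] Ac Ar; split=> // i j Aij.
case: (eqVneq i j) => [->|ij]; first exact: reach_refl.
have [H1 H2] := iA _ _ Aij.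
have jk : (j : nat) <> k.+1.
  move=> jk; move/matrixP/(_ i 0): Ac; rewrite ecol_mulE // -jk inord_val !mxE.
  move=> Aij1; move: Aij; rewrite Aij1; case: (eqVneq (i : nat) j) => [/val_inj ji|];
    last by rewrite eqxx.
  by rewrite ji eqxx in ij.
have ik : (i : nat) <> k.+1.
  move=> ik; move/(congr1 trmx)/matrixP/(_ j 0): Ar.
  rewrite trmx_mul erow_tr ecol_mulE // -ik inord_val !mxE.
  move=> Aij1; move: Aij; rewrite Aij1; case: (eqVneq (j : nat) i) => [/val_inj ji|];
    last by rewrite eqxx.
  by rewrite ji eqxx in ij.
split=> t tt.
  by split; [case: (H1 t tt) | case: (ltngtP i j) (H1 j.-1); lia].
by split; [case: (H2 t tt) | case: (ltngtP i j) (H2 i.-1); lia].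
Qed.

(** Gaussian elimination: the pivot 1 in the corner clears its column by a left factor and its row
    by a right factor. What remains fixes index k+1, so it belongs to P_k. *)
Lemma inc_group_cell1 S k A : (k < n)%N -> inc_group S k.+1 A ->
  erow k.+1 *m (A *m ecol k.+1) = 1%:M ->
  exists B r, [/\ colsupp (S true) k.+1 (A *m ecol k.+1 + ecol k.+1), inc_group S k B,
    colsupp (S false) k.+1 r^T &
    A = transv (A *m ecol k.+1 + ecol k.+1) (erow k.+1) *m (B *m transv (ecol k.+1) r)].
Proof.
move=> kn PA e1; set v := _ + _; pose r := erow k.+1 *m A + erow k.+1.
have sv : colsupp (S true) k.+1 v by apply: colsupp_col1 => //; case: PA.
have sr : colsupp (S false) k.+1 r^T.
  rewrite linearD /= trmx_mul erow_tr; apply: (@colsupp_col1 (swap S)) => //.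
    by case: (inc_group_tr PA).
  by rewrite erow_mul_tr e1 trmx1.
have erow_v : erow k.+1 *m v = 0 by apply: colsupp_erow0 sv _.
have r_ev : r *m ecol k.+1 = 0 by apply: rowsupp_erow0 sr _.
exists (transv v (erow k.+1) *m (A *m transv (ecol k.+1) r)), r; split=> //; last first.
  by rewrite -!mulmxA transv_inv // mulmx1 mulmxA transv_inv // mul1mx.
apply: inc_group_Sinv => //.
- by apply: inc_groupM; [exact: inc_group_transv_col | apply: inc_groupM => //;
  exact: inc_group_transv_row].
- have AE : A *m ecol k.+1 = v + ecol k.+1 by rewrite addmKr.
  rewrite -!mulmxA (transv_fixv _ r_ev) AE.
  by rewrite transv_mulv mulmxDr erow_v add0r erow_ecol // mulmx1 addrAC addmm add0r.
have AE : erow k.+1 *m A = r + erow k.+1 by rewrite addmKr.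
rewrite mulmxA (transv_fixr _ erow_v) mulmxA AE.
by rewrite mul_transvr mulmxDl r_ev add0r erow_ecol // mul1mx addrAC addmm add0r.
Qed.

(** If the corner entry is 0, a left factor [transv (ecol k.+1) q] first turns it into a pivot 1;
    this needs a row q that takes the value 1 on column k+1 of A. *)
Lemma inc_group_cell S k A : (k < n)%N -> inc_group S k.+1 A ->
  exists q v B r, [/\ [/\ colsupp (S false) k.+1 q^T, colsupp (S true) k.+1 v, inc_group S k B &
    colsupp (S false) k.+1 r^T], (q = 0 \/ q *m v = 1%:M) &
    A = transv (ecol k.+1) q *m (transv v (erow k.+1) *m (B *m transv (ecol k.+1) r))].
Proof.
move=> kn PA; case: (mx1P (erow k.+1 *m (A *m ecol k.+1))) => e0; last first.
  have [B [r [sv PB sr AE]]] := inc_group_cell1 kn PA e0.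
  exists 0, (A *m ecol k.+1 + ecol k.+1), B, r; rewrite transv0r mul1mx trmx0.
  by split; [split=> //; exact: colsupp0 | left |].
have [uA iA] := PA; have [uA' iA'] := inc_groupV PA.
(* Row k+1 of the inverse pairs to 1 with column k+1 of A. Its own corner entry may be dropped,
   because it meets the zero corner of A. *)
have [q sq qA] : exists2 q, colsupp (S false) k.+1 q^T & q *m (A *m ecol k.+1) = 1%:M.
  have iT : incid (swap S) k.+1 (invmx A)^T by case: (inc_group_tr (inc_groupV PA)).
  case: (mx1P (erow k.+1 *m (invmx A *m ecol k.+1))) => c0.
    exists (erow k.+1 *m invmx A).
      by rewrite trmx_mul erow_tr; apply: (@colsupp_col (swap S)) => //;
        rewrite erow_mul_tr c0 trmx0.
    by rewrite -mulmxA mulKmx // erow_ecol.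
  exists (erow k.+1 *m invmx A + erow k.+1).
    by rewrite linearD /= trmx_mul erow_tr; apply: (@colsupp_col1 (swap S)) => //;
      rewrite erow_mul_tr c0 trmx1.
  by rewrite mulmxDl e0 addr0 -mulmxA mulKmx // erow_ecol.
have PA' : inc_group S k.+1 (transv (ecol k.+1) q *m A) by apply: inc_groupM => //;
  apply: inc_group_transv_row.
have q_ev : q *m ecol k.+1 = 0 by apply: rowsupp_erow0 sq _.
have [|B [r [sv PB sr AE]]] := inc_group_cell1 kn PA'.
  by rewrite -mulmxA transv_mulv mulmxDr e0 add0r qA mulmx1 erow_ecol.
exists q, (transv (ecol k.+1) q *m A *m ecol k.+1 + ecol k.+1), B, r; split; [split;
  [exact: sq | exact: sv | exact: PB | exact: sr]| right |].
  by rewrite mulmxDr q_ev addr0 -mulmxA mulmxA transv_fixr.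
by rewrite -AE mulmxA transv_inv // mul1mx.
Qed.

Lemma transv_comm S k a : (k < n)%N -> colsupp (S true) k a ->
  transv a (erow k) *m gen_mx true k = transv (a + ecol k) (erow k.+1) *m transv a (erow k).
Proof.
move=> kn sa; have ea : erow k *m a = 0 by apply: colsupp_erow0 sa _.
have ea' : erow k.+1 *m a = 0 by apply: colsupp_erow0 sa _.
rewrite gen_mx_col (transv_conj _ _ (transv_unit ea)).
rewrite (transv_mulv a) (erow_ecol (ltnW kn)) mulmx1 [ecol k + a]addrC.
rewrite -{1}(transv_fixr (erow k) ea').
by rewrite (mulmxK (transv_unit ea)).
Qed.

(** Both factors are involutions, so the square of their product is their commutator. This formula
    forces the column map on vectors with zero entry at [k]. *)
Lemma transv_square S k a : (k < n)%N -> colsupp (S true) k a ->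
  transv a (erow k.+1) = (transv a (erow k) *m gen_mx true k) *m (transv a (erow k) *m
    gen_mx true k).
Proof.
move=> kn sa; have C := transv_comm kn sa.
have ea : erow k *m a = 0 by apply: colsupp_erow0 sa _.
have ek : erow k.+1 *m ecol k = 0 by apply: erow_ecol0; lia.
rewrite {1}C -mulmxA (mulmxA (transv a _) (transv a _)) (transv_inv ea) mul1mx.
by rewrite gen_mx_col (transvDl _ ek) addmKr.
Qed.

(** Commutators produce the transvections whose vector has entry 0 at [k]; the others differ from
    these by one factor [gen_mx true k]. *)
Lemma gen_col S k (H : M -> Prop) v : (k < n)%N ->
  (forall A B, H A -> H B -> H (A *m B)) -> (forall A, inc_group S k A -> H A) ->
  (S true k -> H (gen_mx true k)) -> colsupp (S true) k.+1 v -> H (transv v (erow k.+1)).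
Proof.
move=> kn HM HP HX sv; have [Sk|nSk] := boolP (S true k); last first.
  by rewrite (colsupp_nT nSk sv) transv0l; apply: HP; exact: inc_group1.
have {HX} HX := HX Sk.
have ek : erow k.+1 *m ecol k = 0 by apply: erow_ecol0; lia.
have Ha a : colsupp (S true) k a -> H (transv a (erow k.+1)).
  move=> sa; have HC : H (transv a (erow k)) by apply: HP; apply: inc_group_transv_col.
  by rewrite (transv_square kn sa); apply: (HM); apply: (HM).
case: (colsuppS (ltnW kn) sv) => a sa [->|[_ ->]]; first exact: Ha.
by rewrite -transvDl //; apply: HM => //; apply: Ha.
Qed.

Lemma gen_row S k (H : M -> Prop) q : (k < n)%N ->
  (forall A B, H A -> H B -> H (A *m B)) -> (forall A, inc_group S k A -> H A) ->
  (S false k -> H (gen_mx false k)) -> colsupp (S false) k.+1 q^T -> H (transv (ecol k.+1) q).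
Proof.
move=> kn HM HP HX sq; rewrite -[transv _ _]trmxK transv_tr ecol_tr.
apply: (@gen_col (swap S) k (fun A => H A^T)) => //.
- by move=> A B HA HB; rewrite trmx_mul; apply: HM.
- by move=> A /inc_group_trV; apply: HP.
by rewrite gen_mx_tr.
Qed.

(** Elimination reduces P_{k+1} to P_k and to the transvections of [gen_col] and [gen_row]. As only
    closure under products is asked of [H], this serves as the induction principle on generators. *)
Lemma inc_group_gen S k (H : M -> Prop) : (k <= n)%N -> H 1%:M ->
  (forall A B, H A -> H B -> H (A *m B)) ->
  (forall b i, (i < k)%N -> S b i -> H (gen_mx b i)) ->
  forall A, inc_group S k A -> H A.
Proof.
move=> kn H1 HM; elim: k kn => [|k IH] kn HX A PA; first by rewrite (inc_group_0 PA).
have {}IH B : inc_group S k B -> H B.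
  by apply: IH => [|b i ik]; [exact: ltnW | apply: HX; exact: ltnW].
have [q [v [B [r [[sq sv PB sr] _ ->]]]]] := inc_group_cell kn PA.
have Hrow q' : colsupp (S false) k.+1 q'^T -> H (transv (ecol k.+1) q').
  by apply: gen_row => // Sk; apply: HX.
apply: (HM); first exact: Hrow.
apply: (HM); last by apply: (HM); [exact: IH | exact: Hrow].
by apply: gen_col IH _ sv => // Sk; apply: HX.
Qed.

Lemma inc_group_gen_mx S b i k : (i < k)%N -> (k <= n)%N -> S b i -> inc_group S k (gen_mx b i).
Proof.
move=> ik kn; suff PT (S' : bool -> nat -> bool) : S' true i -> inc_group S' k (gen_mx true i).
  case: b; first exact: PT.
  by move=> Si; rewrite -[gen_mx _ _]trmxK gen_mx_tr; apply: inc_group_trV; apply: PT.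
move=> Si; have: inc_group S' i.+1 (gen_mx true i) by apply: inc_group_transv_col;
  exact: colsupp_ecol.
elim: k ik {kn} => // k IH; rewrite ltnS leq_eqVlt => /orP[/eqP-> //|ik] PX.
by apply: inc_group_S; apply: IH.
Qed.

End Generation.

(** * Extending a homomorphism by one row and one column *)

Section Extend.
Local Open Scope ring_scope.
Variables (n : nat) (G : groupType) (S : bool -> nat -> bool) (k : nat).
Notation M := 'M['F_2]_n.+1.
Notation cV := 'cV['F_2]_n.+1.
Notation rV := 'rV['F_2]_n.+1.
Notation ecol := (ecol n).
Notation erow := (erow n).
Implicit Types (A B : M) (u v w : cV) (q r : rV).
Hypothesis kn : (k < n)%N.

Notation V := (colsupp (S true) k.+1).
Definition rowsupp (T : nat -> bool) l q := colsupp T l q^T.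
Notation R := (rowsupp (S false) k.+1).
Notation U v := (transv v (erow k.+1)).
Notation L q := (transv (ecol k.+1) q).

Variables (phi : M -> G) (psi : cV -> G) (rho : rV -> G).
Hypothesis phiM : forall A B, inc_group S k A -> inc_group S k B -> phi (A *m B) =
  (phi A * phi B)%g.
Hypothesis psiD : forall v w, V v -> V w -> psi (v + w) = (psi v * psi w)%g.
Hypothesis rhoD : forall q r, R q -> R r -> rho (q + r) = (rho q * rho r)%g.
Hypothesis phi_psi : forall A v, inc_group S k A -> V v -> (phi A * psi v = psi (A *m v) * phi A)%g.
Hypothesis phi_rho : forall A q, inc_group S k A -> R q -> (rho q * phi A = phi A * rho (q *m A))%g.
Hypothesis K : forall q v, R q -> V v -> q *m v = 0 ->
  (rho q * psi v = psi v * phi (transv v q) * rho q)%g.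
Hypothesis braid : forall q, S true k -> S false k -> R q -> q *m ecol k = 1%:M ->
  (psi (ecol k) * rho q * psi (ecol k) = rho q * psi (ecol k) * rho q)%g.

Lemma rowsuppD (T : nat -> bool) l q r : rowsupp T l q -> rowsupp T l r -> rowsupp T l (q + r).
Proof. by move=> sq sr; rewrite /rowsupp linearD /=; apply: colsuppD. Qed.

Lemma rowsupp0 (T : nat -> bool) l : rowsupp T l 0.
Proof. by rewrite /rowsupp trmx0; exact: colsupp0. Qed.

Lemma rowsupp_erow (T : nat -> bool) l : T l -> rowsupp T l.+1 (erow l).
Proof. by move=> Tl; rewrite /rowsupp erow_tr; exact: colsupp_ecol. Qed.

Lemma RM q A : R q -> inc_group S k A -> R (q *m A).
Proof. by move=> Rq PA; apply: rowsupp_mul. Qed.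

Lemma idem_eq1 (g : G) : (g = g * g)%g -> g = 1%g.
Proof. by move=> gg; apply: (mulgI g); rewrite mulg1. Qed.

Lemma hom_mx1 : phi 1%:M = 1%g.
Proof. by apply: idem_eq1; rewrite -(phiM (inc_group1 n S k) (inc_group1 n S k)) mulmx1. Qed.
Lemma col_hom0 : psi 0 = 1%g.
Proof. by apply: idem_eq1; rewrite -(psiD (colsupp0 _ _) (colsupp0 _ _)) addr0. Qed.
Lemma row_hom0 : rho 0 = 1%g.
Proof. by apply: idem_eq1; rewrite -(rhoD (rowsupp0 _ _) (rowsupp0 _ _)) addr0. Qed.

Lemma erow_V v : V v -> erow k.+1 *m v = 0.
Proof. by move=> sv; apply: colsupp_erow0 sv _. Qed.
Lemma R_ev q : R q -> q *m ecol k.+1 = 0.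
Proof. by move=> sq; apply: rowsupp_erow0 sq _. Qed.


Lemma mx_ecol_R B r : inc_group S k B -> R r -> B *m L r *m ecol k.+1 = ecol k.+1.
Proof. by move=> PB Rr; rewrite -mulmxA (transv_fixv _ (R_ev Rr)) (inc_group_fixv PB). Qed.

Lemma transv_conjI A v q : A *m A = 1%:M -> A *m transv v q = transv (A *m v) (q *m A) *m A.
Proof.
by move=> AA; rewrite /transv mulmxDl mulmxDr mulmx1 mul1mx -!mulmxA AA mulmx1.
Qed.

(** Conjugating U(v) by L(q) fixes v and adds q to the row; this summand contributes the factor
    [transv v q], an element of P_k. Hypothesis [K] is the same identity in G. *)
Lemma mxLU q v : R q -> V v -> q *m v = 0 -> L q *m U v = U v *m (transv v q *m L q).
Proof.
move=> Rq Vv qv; rewrite (transv_conjI _ _ (transv_inv (R_ev Rq))) (transv_fixv _ qv).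
rewrite mul_transvr (erow_ecol kn) mul1mx mulmxA; congr (_ *m _).
by rewrite (transvDr _ (erow_V Vv)).
Qed.

Lemma mxAU A v : inc_group S k A -> A *m U v = U (A *m v) *m A.
Proof.
move=> PA; rewrite transv_conj; last by case: PA.
by rewrite (inc_group_fixr (inc_groupV PA)).
Qed.

Lemma mxLA A q : inc_group S k A -> L q *m A = A *m L (q *m A).
Proof.
move=> PA; have [uA _] := PA.
by rewrite (transv_conj _ _ uA) (inc_group_fixv PA) // mulmxK.
Qed.

Definition cell q v B r := L q *m (U v *m (B *m L r)).
Definition gcell q v B r := (rho q * (psi v * (phi B * rho r)))%g.
Definition inC v B r := [/\ V v, inc_group S k B & R r].

Lemma inc_group_transvk q v : R q -> V v -> q *m v = 0 -> inc_group S k (transv v q).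
Proof. by move=> Rq Vv; apply: inc_group_transv. Qed.

(** The left factor is absorbed: moved past U(v) it leaves [transv v q], moved past B it becomes
    L(qB) and merges with L(r). The same moves in G give [gcell_shift]. *)
Lemma cell_shift q v B r : R q -> q *m v = 0 -> inC v B r ->
  L q *m (U v *m (B *m L r)) = U v *m ((transv v q *m B) *m L (q *m B + r)).
Proof.
move=> Rq qv [Vv PB Rr]; rewrite (mulmxA (L q)) (mxLU Rq Vv qv) -!mulmxA.
congr (_ *m (_ *m _)); rewrite (mulmxA (L q)) (mxLA _ PB) -!mulmxA.
by rewrite transvDr // R_ev //; apply: RM.
Qed.

Lemma gcell_shift q v B r : R q -> q *m v = 0 -> inC v B r ->
  (rho q * (psi v * (phi B * rho r)) = psi v * (phi (transv v q *m B) * rho (q *m B + r)))%g.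
Proof.
move=> Rq qv [Vv PB Rr]; rewrite (phiM (inc_group_transvk Rq Vv qv) PB) (rhoD (RM Rq PB) Rr).
by rewrite (mulgA (rho q)) (K Rq Vv qv) -!mulgA (mulgA (rho q)) (phi_rho PB Rq) -!mulgA.
Qed.

Lemma inC_shift q v B r : R q -> q *m v = 0 -> inC v B r ->
  inC v (transv v q *m B) (q *m B + r).
Proof.
move=> Rq qv [Vv PB Rr]; split=> //; first by apply: inc_groupM => //; apply: inc_group_transvk.
by apply: rowsuppD => //; apply: RM.
Qed.

Lemma cell1_uniq v B r B' r' : inC v B r -> inC v B' r' ->
  U v *m (B *m L r) = U v *m (B' *m L r') -> B = B' /\ r = r'.
Proof.
move=> [Vv PB Rr] [_ PB' Rr'] /(congr1 (mulmx (U v))).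
rewrite !(mulmxA (U v)) !(transv_inv (erow_V Vv)) !mul1mx => E.
have rr : r = r'.
  move/(congr1 (mulmx (erow k.+1))): E;
    rewrite !mulmxA (inc_group_fixr PB) // (inc_group_fixr PB') //.
  by rewrite !mul_transvr (erow_ecol kn) !mul1mx => /addrI.
split=> //; move/(congr1 (mulmx^~ (L r))): E.
by rewrite -rr -!mulmxA (transv_inv (R_ev Rr)) !mulmx1.
Qed.

Lemma U_cell_ecol v B r : inC v B r -> U v *m (B *m L r) *m ecol k.+1 = ecol k.+1 + v.
Proof.
by move=> [Vv PB Rr]; rewrite -mulmxA (mx_ecol_R PB Rr) transv_mulv (erow_ecol kn) mulmx1.
Qed.

(* Evaluating both sides on [ecol k.+1] forces [v = v'] and [(q' + q) v = 0]. *)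
Lemma cell_uniq q v B r q' v' B' r' : R q -> R q' -> inC v B r -> inC v' B' r' ->
  cell q v B r = cell q' v' B' r' -> gcell q v B r = gcell q' v' B' r'.
Proof.
move=> Rq Rq' C C' /(congr1 (mulmx (L q'))).
rewrite /cell (mulmxA (L q') (L q')) (transv_inv (R_ev Rq')) mul1mx.
rewrite (mulmxA (L q')) (transvDr _ (R_ev Rq')); set d := q' + q => E.
have Rd : R d by apply: rowsuppD.
have [Vv PB Rr] := C; have [Vv' PB' Rr'] := C'.
have dv : ecol k.+1 *m (d *m v) = v + v'.
  move/(congr1 (mulmx^~ (ecol k.+1))): E; rewrite -mulmxA (U_cell_ecol C) (U_cell_ecol C').
  rewrite transv_mulv mulmxDr (R_ev Rd) add0r -addrA => /addrI <-.
  by rewrite addmKl.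
have dv0 : d *m v = 0.
  move/(congr1 (mulmx (erow k.+1))): dv.
  by rewrite mulmxA (erow_ecol kn) mul1mx mulmxDr (erow_V Vv) (erow_V Vv') addr0.
have vv : v = v' by apply: addm_eq0; rewrite -dv dv0 mulmx0.
move: C' E; rewrite -vv => C' E; move: E; rewrite (cell_shift Rd dv0 C).
move=> /(cell1_uniq (inC_shift Rd dv0 C) C') [<- <-].
have qd : q = q' + d by rewrite addmKl.
by rewrite /gcell -(gcell_shift Rd dv0 C) qd (rhoD Rq' Rd) -mulgA.
Qed.

(** The graph of the extension. It is a relation at first because A need not determine q; [val_uniq]
    shows that it is single-valued. *)
Definition val_of (A : M) (g : G) := exists q v B r,
  [/\ R q, inC v B r, q = 0 \/ q *m v = 1%:M, A = cell q v B r & g = gcell q v B r].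

Lemma val_uniq A g g' : val_of A g -> val_of A g' -> g = g'.
Proof.
move=> [q [v [B [r [Rq C _ -> ->]]]]] [q' [v' [B' [r' [Rq' C' _ E ->]]]]].
exact: cell_uniq E.
Qed.

Lemma val_ex A : inc_group S k.+1 A -> exists g, val_of A g.
Proof.
move=> /(inc_group_cell kn) [q [v [B [r [[Rq Vv PB Rr] qv AE]]]]].
by exists (gcell q v B r), q, v, B, r; split.
Qed.

Lemma val1 v B r : inC v B r ->
  val_of (U v *m (B *m L r)) (psi v * (phi B * rho r))%g.
Proof.
move=> C; exists 0, v, B, r; split=> //; [exact: rowsupp0 | by left | |].
  by rewrite /cell transv0r mul1mx.
by rewrite /gcell row_hom0 mul1g.
Qed.

Lemma val2 q v B r : R q -> inC v B r -> q *m v = 1%:M ->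
  val_of (L q *m (U v *m (B *m L r))) (rho q * (psi v * (phi B * rho r)))%g.
Proof. by move=> Rq C qv; exists q, v, B, r; split=> //; right. Qed.

(** Conjugation by A carries L(q) and U(v) to L(q A^-1) and U(A v), which preserves the scalar q v
    and hence the type of the cell. *)
Lemma val_P A B g : inc_group S k A -> val_of B g -> val_of (A *m B) (phi A * g)%g.
Proof.
move=> PA [q [v [B' [r [Rq C qv -> ->]]]]].
have [Vv PB Rr] := C; have [uA _] := PA.
have RqA : R (q *m invmx A) by apply: RM => //; apply: inc_groupV.
have C' : inC (A *m v) (A *m B') r.
  by split=> //; [apply: colsupp_mul | apply: inc_groupM].
exists (q *m invmx A), (A *m v), (A *m B'), r; split=> //.
- by case: qv => [->|qv]; [left; rewrite mul0mx | right; rewrite mulmxA mulmxKV].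
- rewrite /cell (mulmxA A) -[in LHS](mulmxKV uA q) -(mxLA _ PA) -!mulmxA.
  by congr (_ *m _); rewrite [LHS]mulmxA (mxAU _ PA) -!mulmxA.
rewrite /gcell (phiM PA PB) (mulgA (phi A)) -{1}(mulmxKV uA q).
rewrite -(phi_rho PA RqA) -!mulgA; congr (_ * _)%g.
by rewrite [LHS]mulgA (phi_psi PA Vv) -!mulgA.
Qed.

(** The new row e_k^T + q takes on v either the value 1, which gives a cell of the second type, or
    the value 0, and then the left factor is absorbed. *)
Lemma val_L B g : S false k -> val_of B g ->
  val_of (L (erow k) *m B) (rho (erow k) * g)%g.
Proof.
move=> Sk [q [v [B' [r [Rq C qv -> ->]]]]].
have Re : R (erow k) by apply: rowsupp_erow.
rewrite /cell /gcell mulmxA (transvDr _ (R_ev Re)) mulgA -(rhoD Re Rq).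
have Rq' : R (erow k + q) by apply: rowsuppD.
case: (mx1P ((erow k + q) *m v)) => eqv.
  rewrite (cell_shift Rq' eqv C) (gcell_shift Rq' eqv C).
  by apply: val1; apply: inC_shift.
exact: val2.
Qed.

(** Each side is one involution conjugated by the other, and both are the transvection with vector
    e_{k+1} + v and row e_{k+1}^T + q. *)
Lemma mx_braid q v : R q -> V v -> q *m v = 1%:M ->
  U v *m L q *m U v = L q *m U v *m L q.
Proof.
move=> Rq Vv qv.
rewrite (transv_conjI _ _ (transv_inv (erow_V Vv))) -mulmxA (transv_inv (erow_V Vv)) mulmx1.
rewrite (transv_conjI _ _ (transv_inv (R_ev Rq))) -mulmxA (transv_inv (R_ev Rq)) mulmx1.
by rewrite !transv_mulv !mul_transvr (erow_ecol kn) qv !mulmx1 !mul1mx addrC [q + _]addrC.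
Qed.

(** Three cases: q = 0, where only v changes; q e_k = 0, where U(e_k) passes L(q) up to a factor in
    P_k; q e_k = 1, where the braid relation applies. *)
Lemma val_U B g : S true k -> val_of B g ->
  val_of (U (ecol k) *m B) (psi (ecol k) * g)%g.
Proof.
move=> Sk [q [v [B' [r [Rq C qv -> ->]]]]]; rewrite /cell /gcell.
have Ve : V (ecol k) by apply: colsupp_ecol.
have [Vv PB Rr] := C.
have Vve : V (ecol k + v) by apply: colsuppD.
have Cve : inC (ecol k + v) B' r by split.
case: qv => [->|qv].
  rewrite row_hom0 transv0r mul1g mul1mx mulmxA (transvDl _ (erow_V Vv)) mulgA -(psiD Ve Vv).
  exact: val1.
case: (mx1P (q *m ecol k)) => qe.
  have PE := inc_group_transvk Rq Ve qe; set E := transv (ecol k) q in PE *.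
  have EE : phi E = (phi E)^-1%g.
    by apply: (mulgI (phi E)); rewrite mulgV -(phiM PE PE) (transv_inv qe) hom_mx1.
  (* This is [K] solved for the other order: phi(E) is an involution that commutes with psi(e_k). *)
  have gE : (psi (ecol k) * rho q = phi E * (rho q * psi (ecol k)))%g.
    rewrite (K Rq Ve qe) -/E !mulgA (phi_psi PE Ve) (transv_fixv _ qe).
    by rewrite -(mulgA (psi _)) {2}EE mulgV mulg1.
  have mE : U (ecol k) *m L q = E *m (L q *m U (ecol k)).
    rewrite (mxLU Rq Ve qe) -/E mulmxA (mxAU _ PE) (transv_fixv _ qe) -!mulmxA.
    by rewrite (mulmxA E) (transv_inv qe) mul1mx.
  rewrite mulmxA mE mulgA gE -!mulmxA -!mulgA.
  rewrite (mulmxA (U (ecol k))) (transvDl _ (erow_V Vv)) (mulgA (psi _)) -(psiD Ve Vv).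
  by apply: val_P => //; apply: val2 => //; rewrite mulmxDr qe add0r.
have Sk' : S false k.
  apply: contraT => /colsupp_nT /(_ Rq) q0; case: (@mx1_neq01).
  by rewrite -qe -[q]trmxK q0 trmx0 mul0mx.
(* Split v as e_k + (e_k + v). The braid relation turns U(e_k) L(q) U(e_k) into L(q) U(e_k) L(q),
   and the last L(q) is absorbed because q vanishes on e_k + v. *)
have qve : q *m (ecol k + v) = 0 by rewrite mulmxDr qe qv addmm.
have -> : psi v = (psi (ecol k) * psi (ecol k + v))%g by rewrite -(psiD Ve Vve) addmKl.
have -> : U v = U (ecol k) *m U (ecol k + v) by rewrite (transvDl _ (erow_V Vve)) addmKl.
rewrite -!mulmxA -!mulgA.
rewrite (mulmxA (L q)) (mulmxA (U (ecol k)) (_ *m _)) (mulmxA (U (ecol k)) (L q)).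
rewrite (mx_braid Rq Ve qe) -!mulmxA (cell_shift Rq qve Cve).
rewrite (mulgA (rho q)) (mulgA (psi (ecol k)) (_ * _)%g) (mulgA (psi (ecol k)) (rho q)).
rewrite (braid Sk Sk' Rq qe) -!mulgA (gcell_shift Rq qve Cve).
rewrite (mulmxA (U (ecol k))) (transvDl _ (erow_V Vve)) addmKl.
rewrite (mulgA (psi (ecol k))) -(psiD Ve Vve) addmKl.
apply: val2 => //.
by have [? ? ?] := inC_shift Rq qve Cve; split.
Qed.

Lemma hom_extend : exists phi' : M -> G,
  [/\ forall A B, inc_group S k.+1 A -> inc_group S k.+1 B -> phi' (A *m B) = (phi' A * phi' B)%g,
      forall A, inc_group S k A -> phi' A = phi A,
      S true k -> phi' (gen_mx n true k) = psi (ecol k) &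
      S false k -> phi' (gen_mx n false k) = rho (erow k)].
Proof.
(* Outside P_{k+1} any value serves; 1 is taken to make the choice total. *)
have valE A : exists g, inc_group S k.+1 A -> val_of A g.
  by case: (boolp.pselect (inc_group S k.+1 A)) => [/val_ex[g gA]|nPA]; [exists g | exists 1%g].
have [phi' phi'inc_group] := boolp.choice valE.
have phi'E A g : inc_group S k.+1 A -> val_of A g -> phi' A = g.
  by move=> /phi'inc_group v1 v2; apply: val_uniq v1 v2.
have v1 : val_of 1%:M 1%g.
  have := @val1 0 1%:M 0; rewrite col_hom0 hom_mx1 row_hom0 !mulg1 transv0l transv0r !mulmx1; apply.
  by split; [exact: colsupp0 | exact: inc_group1 | exact: rowsupp0].
have phi'k A : inc_group S k A -> phi' A = phi A.
  move=> PA; apply: phi'E; first exact: inc_group_S.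
  by have := val_P PA v1; rewrite mulmx1 mulg1.
have phi'U : S true k -> phi' (gen_mx n true k) = psi (ecol k).
  move=> Sk; apply: phi'E; first by apply: inc_group_gen_mx.
  by have := val_U Sk v1; rewrite mulmx1 mulg1.
have phi'L : S false k -> phi' (gen_mx n false k) = rho (erow k).
  move=> Sk; apply: phi'E; first by apply: inc_group_gen_mx.
  by have := val_L Sk v1; rewrite mulmx1 mulg1.
exists phi'; split=> //.
(* The matrices whose left multiplication is respected are closed under products, so only generators
   remain: [val_P] for index below [k], [val_U] and [val_L] for index [k]. *)
pose H A := inc_group S k.+1 A /\ forall B, inc_group S k.+1 B -> phi' (A *m B) =
  (phi' A * phi' B)%g.
suff HP A : inc_group S k.+1 A -> H A by move=> A B PA; have [_ ] := HP A PA; apply.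
move: A; apply: inc_group_gen => //.
- split; first exact: inc_group1.
  by move=> B PB; rewrite mul1mx (phi'k _ (inc_group1 n S k)) hom_mx1 mul1g.
- move=> A B [PA HA] [PB HB]; split; first exact: inc_groupM.
  move=> D PD; rewrite -mulmxA HA ?HB ?HA // ?mulgA //; exact: inc_groupM.
move=> b i ik Sbi; have PX : inc_group S k.+1 (gen_mx n b i) by apply: inc_group_gen_mx.
split=> // B PB; apply: phi'E; first exact: inc_groupM.
have vB := phi'inc_group B PB.
case: (ltnP i k) => [ik'|ki].
  have PXk : inc_group S k (gen_mx n b i) by apply: inc_group_gen_mx => //; exact: ltnW.
  by rewrite phi'k //; apply: val_P.
have {ki ik} ik : i = k by lia.
move: Sbi; rewrite ik; case: b {PX} => Sk.
  by rewrite phi'U //; apply: val_U.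
by rewrite phi'L //; apply: val_L.
Qed.

End Extend.

(** * Consequences of the Coxeter relations *)

Section Words.
Local Open Scope group_scope.
Variable G : groupType.
Implicit Types a b c t x y w : G.

Lemma inv2 a : a ^+ 2 = 1 -> a^-1 = a.
Proof. by move=> aa; apply: mulg1_eq. Qed.

Lemma inv2K a : a ^+ 2 = 1 -> forall z, a * (a * z) = z.
Proof. by move=> aa z; rewrite mulgA -[a * a]expg2 aa mul1g. Qed.

Lemma commE a b : a ^+ 2 = 1 -> b ^+ 2 = 1 -> (a * b) ^+ 2 = 1 -> a * b = b * a.
Proof. by move=> a2 b2 /inv2 <-; rewrite invgM !inv2. Qed.

Lemma braidE a b : a ^+ 2 = 1 -> b ^+ 2 = 1 -> (a * b) ^+ 3 = 1 ->
  a * b * a = b * a * b.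
Proof.
move=> a2 b2 ab; have /mulg1_eq <- : a * b * a * (b * a * b) = 1.
  by rewrite -ab !expgS expg0 mulg1 !mulgA.
by rewrite !invgM !inv2 // mulgA.
Qed.

Lemma sq4E a b : a ^+ 2 = 1 -> b ^+ 2 = 1 -> (a * b) ^+ 4 = 1 ->
  a * b * a * b = b * a * b * a.
Proof.
move=> a2 b2 ab; have /mulg1_eq <- : a * b * a * b * (a * b * a * b) = 1.
  by rewrite -ab !expgS expg0 mulg1 !mulgA.
by rewrite !invgM !inv2 // !mulgA.
Qed.

Lemma word_square t x : t ^+ 2 = 1 -> x ^+ 2 = 1 -> (t * x) ^+ 4 = 1 ->
  commute t (t * x * t * x).
Proof. by move=> t2 x2 tx; rewrite /commute {1}(sq4E t2 x2 tx) !mulgA. Qed.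

(** Since a and c commute, (ab)^2 (bc)^2 = (abc)^2. Both factors and the product square to 1, so the
    factors commute. *)
Lemma word_chain a b c : a ^+ 2 = 1 -> b ^+ 2 = 1 -> c ^+ 2 = 1 ->
  (a * c) ^+ 2 = 1 -> (a * b) ^+ 4 = 1 -> (b * c) ^+ 4 = 1 ->
  (a * b * c) ^+ 4 = 1 -> commute (a * b * a * b) (b * c * b * c).
Proof.
move=> a2 b2 c2 /(commE a2 c2) ac ab bc abc.
rewrite /commute.
have -> : a * b * a * b * (b * c * b * c) = (a * b * c) ^+ 2.
  by rewrite -!mulgA (inv2K b2) (mulgA a c) ac expg2 -!mulgA.
have <- : ((a * b * c) ^+ 2)^-1 = (a * b * c) ^+ 2.
  by apply: mulg1_eq; rewrite -abc !expgS expg0 !mulg1 !mulgA.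
rewrite (sq4E a2 b2 ab) (sq4E b2 c2 bc) expg2 !invgM !inv2 // -!mulgA (inv2K b2).
by rewrite (mulgA c a) -ac -!mulgA.
Qed.

(* Used with [t = tau a] and [x = xk]. *)
Lemma word_sq_comm t x : t ^+ 2 = 1 -> x ^+ 2 = 1 -> commute t (t * x * t * x) ->
  commute x (t * x * t * x).
Proof.
move=> t2 x2; rewrite /commute -!mulgA (inv2K t2) => tx.
have E : t * (x * (t * x)) = x * (t * (x * t)).
  by rewrite tx (inv2K t2).
by rewrite {1}E (inv2K x2) -[x * x]expg2 x2 mulg1.
Qed.

(* In the notation of the header: [w = u_{k-1}], [x = u_k], [y = l_{k-1}]. *)
Lemma word_lo w x y : w ^+ 2 = 1 -> x ^+ 2 = 1 -> y ^+ 2 = 1 ->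
  x * y = y * x -> (w * y) ^+ 3 = 1 -> (w * x * y) ^+ 3 = 1 -> (w * x) ^+ 4 = 1 ->
  y * (w * x * w * x) = w * x * w * x * x * y.
Proof.
move=> w2 x2 y2 xy wy wxy wx.
have br := braidE w2 y2 wy.
(* As x and y commute, (w x y)^3 = 1 is a braid relation between w and the involution x y. *)
have E : w * (x * y) * w = x * y * w * (x * y).
  have /mulg1_eq <- : w * (x * y) * w * (x * y * w * (x * y)) = 1.
    by rewrite -wxy !expgS expg0 mulg1 !mulgA.
  by rewrite !invgM !inv2 // xy !mulgA.
have Ez z : w * (x * (y * (w * z))) = x * (y * (w * (x * (y * z)))).
  by move/(congr1 (mulg^~ z)): E; rewrite -!mulgA.
have ywy : w * y = y * (w * (y * w)).
  by rewrite !mulgA -br -[RHS]mulgA -[w * w]expg2 w2 mulg1.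
have xyz z : y * (x * z) = x * (y * z) by rewrite !mulgA xy.
have E2 : y * (w * (x * (w * y))) = w * (x * (w * x)).
  rewrite ywy Ez (inv2K y2) xyz (inv2K y2).
  by move: (sq4E w2 x2 wx); rewrite -!mulgA => ->.
have -> : y * (w * x * w * x) = y * (w * (x * (w * y))) * (y * x).
  by rewrite -!mulgA (inv2K y2).
by rewrite E2 -!mulgA xy.
Qed.

(* In the notation of the header: [x = u_k], [y = l_k], [z = l_{k-1}]. *)
Lemma word_hi x y z : x ^+ 2 = 1 -> y ^+ 2 = 1 -> z ^+ 2 = 1 ->
  x * z = z * x -> (x * y) ^+ 3 = 1 -> (z * y) ^+ 4 = 1 -> (z * y * x) ^+ 3 = 1 ->
  z * y * z * y * x = x * z * (z * y * z * y).
Proof.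
move=> x2 y2 z2 xz xy zy zyx; have br := braidE x2 y2 xy.
have E : x * (y * (z * x)) = z * (y * (x * (z * y))).
  have /mulg1_eq : z * y * x * z * y * (x * z * y * x) = 1.
    by rewrite -zyx !expgS expg0 mulg1 !mulgA.
  by move/(congr1 (@inv _)); rewrite invgK !invgM !inv2 // -!mulgA => ->.
have Ez u : x * (y * (z * (x * u))) = z * (y * (x * (z * (y * u)))).
  by move/(congr1 (mulg^~ u)): E; rewrite -!mulgA.
have brz u : y * (x * (y * u)) = x * (y * (x * u)) by rewrite !mulgA br.
have s4 : z * y * z * y = y * z * y * z := sq4E z2 y2 zy.
have zxz u : z * (x * (z * u)) = x * u by rewrite (mulgA z) -xz -mulgA (inv2K z2).
have ss : z * y * z * y * (z * y * z * y) = 1.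
  by rewrite {1}s4 -!mulgA (inv2K z2) (inv2K y2) (inv2K z2) -expg2.
(* With s = (z y)^2, which squares to 1, the claim s x = x z s is equivalent to (x s)^2 = z. *)
have E2 : x * (z * y * z * y) * x * (z * y * z * y) = z.
  rewrite {1}s4 -!mulgA zxz brz Ez (inv2K y2) zxz (inv2K x2).
  by rewrite -{2}[y]mulg1 (inv2K y2) mulg1.
move: (z * y * z * y) E2 ss => s E2 ss {s4}.
by rewrite -[z in x * z]E2 -!mulgA (inv2K x2) ss mulg1.
Qed.

(** Moving y past each of the two letters t creates one p; p commutes with t and x, so the two
    copies meet and cancel. *)
Lemma word_shift y x t p : y * t = t * p * y -> p * t = t * p -> x * p = p * x ->
  y * x = x * y -> p * p = 1 -> y * (t * x * t * x) = t * x * t * x * y.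
Proof.
move=> yt pt xp yx pp.
have yt' z : y * (t * z) = t * (p * (y * z)) by rewrite mulgA yt -!mulgA.
have pt' z : p * (t * z) = t * (p * z) by rewrite mulgA pt -!mulgA.
have xp' z : p * (x * z) = x * (p * z) by rewrite mulgA -xp -!mulgA.
have yx' z : y * (x * z) = x * (y * z) by rewrite mulgA yx -!mulgA.
by rewrite -!mulgA yt' yx' yt' yx xp' pt' (mulgA p p) pp mul1g.
Qed.

End Words.

(** The boolean exchanges the two families, so [rel_lo] and [rel_hi] account for all four kinds of
    mixed triples. Each triple is listed in one order only; the other orders come from
    [pow_perm3]. *)
Record coxeter_rels (G : groupType) (S : bool -> nat -> bool) (x : bool -> nat -> G) : Prop :=
  CoxeterRels {
  rel_sq b i : S b i -> (x b i ^+ 2 = 1)%g;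
  rel_far b i j : S b i -> S b j -> (i.+1 < j)%N -> ((x b i * x b j) ^+ 2 = 1)%g;
  rel_opp b i j : S b i -> S (~~ b) j -> i != j -> ((x b i * x (~~ b) j) ^+ 2 = 1)%g;
  rel_same b i : S b i -> S (~~ b) i -> ((x b i * x (~~ b) i) ^+ 3 = 1)%g;
  rel_adj b i : S b i -> S b i.+1 -> ((x b i * x b i.+1) ^+ 4 = 1)%g;
  rel_chain b i : S b i -> S b i.+1 -> S b i.+2 ->
    ((x b i * x b i.+1 * x b i.+2) ^+ 4 = 1)%g;
  rel_lo b i : S b i -> S b i.+1 -> S (~~ b) i ->
    ((x b i * x b i.+1 * x (~~ b) i) ^+ 3 = 1)%g;
  rel_hi b i : S b i -> S b i.+1 -> S (~~ b) i.+1 ->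
    ((x b i * x b i.+1 * x (~~ b) i.+1) ^+ 3 = 1)%g }.

Lemma rels_swap (G : groupType) S (x : bool -> nat -> G) :
  coxeter_rels S x -> coxeter_rels (swap S) (swap x).
Proof.
case=> sq far opp same adj chain lo hi; split=> b; rewrite /swap.
- exact: sq.
- exact: far.
- exact: opp.
- exact: same.
- exact: adj.
- exact: chain.
- exact: lo.
- exact: hi.
Qed.

(** Transport of a commutation along conjugation by g, used to spread one Coxeter relation over an
    orbit. *)
Lemma commute_conj (G : groupType) (g u v u' v' : G) : (g * u = u' * g)%g ->
  (g * v = v' * g)%g -> commute u v -> commute u' v'.
Proof.
move=> gu gv uv; apply: (mulIg g).
by rewrite -!mulgA -gu -gv !mulgA -gu -gv -!mulgA uv.
Qed.

(** * The homomorphism on the vectors of column k+1 *)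

Section ColumnMap.
Local Open Scope ring_scope.
Variables (n : nat) (G : groupType) (S : bool -> nat -> bool) (k : nat).
Variables (x : bool -> nat -> G) (phi : 'M['F_2]_n.+1 -> G).
Notation M := 'M['F_2]_n.+1.
Notation cV := 'cV['F_2]_n.+1.
Notation ecol := (ecol n).
Notation erow := (erow n).
Notation W := (colsupp (S true) k).
Notation V := (colsupp (S true) k.+1).
Implicit Types (A B : M) (a v : cV).

Hypothesis kn : (k < n)%N.
Hypothesis Sk : S true k.
Hypothesis relx : coxeter_rels S x.
Hypothesis phiM : forall A B, inc_group S k A -> inc_group S k B -> phi (A *m B) =
  (phi A * phi B)%g.
Hypothesis phiX : forall b i, (i < k)%N -> S b i -> phi (gen_mx n b i) = x b i.

Let xk := x true k.
Let xk2 : (xk ^+ 2 = 1)%g. Proof. exact: (rel_sq relx Sk). Qed.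

Lemma inc_group_le j l A : (j <= l)%N -> inc_group S j A -> inc_group S l A.
Proof.
elim: l => [|l IH]; first by rewrite leqn0 => /eqP ->.
by rewrite leq_eqVlt => /orP[/eqP -> //|/IH PA] /PA; apply: inc_group_S.
Qed.

Lemma phi_commute (g : G) j A : (j <= k)%N ->
  (forall b i, (i < j)%N -> S b i -> commute g (x b i)) -> inc_group S j A ->
  commute g (phi A).
Proof.
move=> jk gx PA; suff [_ //] : inc_group S k A /\ commute g (phi A).
move: A PA; apply: inc_group_gen; first by lia.
- by split; [exact: inc_group1 | rewrite (hom_mx1 phiM); exact: commute1].
- move=> A B [PA gA] [PB gB]; split; first exact: inc_groupM.
  by rewrite phiM //; apply: commuteM.
move=> b i ij Sbi; have ik : (i < k)%N by lia.
split; first by apply: inc_group_gen_mx => //; exact: ltnW.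
by rewrite phiX //; apply: gx.
Qed.

(** The generators of P_j have index below k-1, so a relation of order two with [xk] is available
    for each of them. *)
Lemma xk_commute j A : (j < k)%N -> inc_group S j A -> commute xk (phi A).
Proof.
move=> jk; apply: phi_commute => [|b i ij Sbi]; first exact: ltnW.
apply: commute_sym; case: b Sbi => Sbi.
  by apply: commE; [exact: (rel_sq relx).. | apply: (rel_far relx); lia].
by apply: commE; [exact: (rel_sq relx).. | apply: (rel_opp relx (b := false)) => //; lia].
Qed.

Definition tau a := phi (transv a (erow k)).
(** The commutator of the involutions [tau a] and [xk], written as a square: by [transv_square] it
    is the only possible image of [transv a (erow k.+1)]. *)
Definition sig a := (tau a * xk * tau a * xk)%g.

Lemma tauD a b : W a -> W b -> tau (a + b) = (tau a * tau b)%g.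
Proof.
move=> Wa Wb; rewrite /tau -phiM; [|exact: inc_group_transv_col..].
by rewrite transvDl // (colsupp_erow0 Wb).
Qed.

Lemma tau0 : tau 0 = 1%g. Proof. by rewrite /tau transv0l (hom_mx1 phiM). Qed.

Lemma tau2 a : W a -> (tau a ^+ 2 = 1)%g.
Proof. by move=> Wa; rewrite expg2 -tauD // addmm tau0. Qed.

Lemma W_mul j A a : (j < k)%N -> inc_group S j A -> W a -> W (A *m a).
Proof.
move=> jk PA; have -> : k = k.-1.+1 by lia.
by apply: colsupp_mul; apply: inc_group_le PA; lia.
Qed.

Lemma phi_tau j A a : (j < k)%N -> inc_group S j A -> W a ->
  (phi A * tau a = tau (A *m a) * phi A)%g.
Proof.
move=> jk PA Wa; have PkA : inc_group S k A by apply: inc_group_le PA; lia.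
rewrite /tau -!phiM //; try by apply: inc_group_transv_col => //; apply: W_mul PA Wa.
by rewrite transv_conj ?(inc_group_fixr (inc_groupV PA)) //; case: PA.
Qed.

Lemma phi_sig j A a : (j < k)%N -> inc_group S j A -> W a ->
  (phi A * sig a = sig (A *m a) * phi A)%g.
Proof.
move=> jk PA Wa; have cx := xk_commute jk PA; have ct := phi_tau jk PA Wa.
by rewrite /sig !mulgA ct -(mulgA _ (phi A)) -cx !mulgA -(mulgA _ (phi A)) ct
  -!mulgA cx.
Qed.

(** Expanding [tau (a + b)] puts [sig b] between [tau a] and its conjugate by [xk]; one commutation
    then separates the two squares. *)
Lemma sigD a b : W a -> W b -> commute (tau a) (sig b) ->
  sig (a + b) = (sig b * sig a)%g.
Proof.
move=> Wa Wb ab; have tab : commute (tau a) (tau b) by rewrite /commute -!tauD // addrC.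
have -> : sig (a + b) = (tau a * sig b * (xk * tau a * xk))%g.
  by rewrite /sig tauD // {2}tab -!mulgA (inv2K xk2).
by rewrite ab /sig -!mulgA.
Qed.

Lemma W_cases a : W a -> a = 0 \/ exists2 j, k = j.+1 & S true j.
Proof.
case: (boolP (S true k.-1)) => Sj Wa; last first.
  case: (posnP k) => [k0|k0].
    left; apply/matrixP=> i j; rewrite ord1 mxE; apply/eqP.
    by apply: contraTT isT => /Wa []; rewrite k0.
  by left; apply: colsupp_nT Sj _; rewrite prednK.
case: (posnP k) => [k0|k0]; last by right; exists k.-1; rewrite ?prednK.
left; apply/matrixP=> i j; rewrite ord1 mxE; apply/eqP.
by apply: contraTT isT => /Wa []; rewrite k0.
Qed.


Lemma W_ecol j : k = j.+1 -> S true j -> W (ecol j).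
Proof. by move=> -> Sj; apply: colsupp_ecol. Qed.

Lemma tau_ecol j : k = j.+1 -> S true j -> tau (ecol j) = x true j.
Proof. by move=> kj Sj; rewrite /tau kj -gen_mx_col phiX // kj. Qed.

Lemma W_of j a : k = j.+1 -> S true j -> colsupp (S true) j a -> W a.
Proof. by move=> -> Sj; apply: colsuppW. Qed.

(** By [transv_square] one level down, tau(e_{k-2}) is the square of u_{k-2} u_{k-1}, while
    sig(e_{k-1}) is the square of u_{k-1} u_k. This is the situation of [word_chain]. *)
Lemma sig_commute_base j i : k = j.+1 -> j = i.+1 -> S true j -> S true i ->
  commute (tau (ecol i)) (sig (ecol j)).
Proof.
move=> kj ji Sj Si; have Wi : colsupp (S true) j (ecol i) by rewrite ji; apply: colsupp_ecol.
have jn : (j < n)%N by lia.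
have PXj : inc_group S k (gen_mx n true j) by apply: inc_group_gen_mx => //; lia.
have PXi : inc_group S k (gen_mx n true i) by apply: inc_group_gen_mx => //; lia.
have -> : tau (ecol i) = (x true i * x true j * x true i * x true j)%g.
  rewrite /tau kj (transv_square (S := S)) // ji -gen_mx_col -ji !phiM //; try exact: inc_groupM.
  by rewrite !phiX ?mulgA //; lia.
rewrite /sig (tau_ecol kj Sj); apply: word_chain.
- exact: (rel_sq relx).
- exact: (rel_sq relx).
- exact: xk2.
- by apply: (rel_far relx) => //; lia.
- by rewrite ji; apply: (rel_adj relx); rewrite -?ji.
- by rewrite /xk kj; apply: (rel_adj relx); rewrite -?kj.
by rewrite /xk kj ji; apply: (rel_chain relx) => //; rewrite -?ji -?kj.
Qed.

Lemma commute_tauD a a' g : W a -> W a' -> commute (tau a) g -> commute (tau a') g ->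
  commute (tau (a + a')) g.
Proof.
by move=> Wa Wa' /commute_sym c /commute_sym c'; rewrite tauD //; apply/commute_sym/commuteM.
Qed.

(* The first point is the relation of length four; the remaining ones are
   transported along the stabilizer of [ecol j]. *)
Lemma sig_commute_ecol j a : k = j.+1 -> S true j -> W a -> commute (tau a) (sig (ecol j)).
Proof.
move=> kj Sj; have Wj := W_ecol kj Sj.
have c0 : commute (tau (ecol j)) (sig (ecol j)).
  rewrite /sig (tau_ecol kj Sj); apply: word_square; rewrite ?(rel_sq relx) //.
  by rewrite /xk kj; apply: (rel_adj relx); rewrite -?kj.
have c1 a' : colsupp (S true) j a' -> commute (tau a') (sig (ecol j)).
  case: (posnP j) => [->|j0 sa'].
    move=> sa'; have -> : a' = 0.
      apply/matrixP=> i l; rewrite ord1 mxE; apply/eqP.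
      by apply: contraTT isT => /sa' [].
    by rewrite tau0; exact/commute_sym/commute1.
  have [i ji] : exists i, j = i.+1 by exists j.-1; rewrite prednK.
  have [Si|nSi] := boolP (S true i); last first.
    move: sa'; rewrite ji => /(colsupp_nT nSi) ->; rewrite tau0; exact/commute_sym/commute1.
  have Wi : W (ecol i) by apply: (W_of kj Sj); rewrite ji; apply: colsupp_ecol.
  have ci := sig_commute_base kj ji Sj Si.
  (* The matrix [transv b (erow i)] moves e_i to b + e_i, fixes e_j, and has an image in G that
     commutes with [xk]. *)
  have cW b : colsupp (S true) i b -> commute (tau (b + ecol i)) (sig (ecol j)).
    move=> sb; have PA : inc_group S i (transv b (erow i)) by apply: inc_group_transv_col.
    have ik : (i < k)%N by lia.
    apply: (@commute_conj _ (phi (transv b (erow i))) _ _ _ _ _ _ ci).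
    - rewrite (phi_tau ik PA Wi) transv_mulv erow_ecol ?mulmx1 1?addrC //; lia.
    rewrite (phi_sig ik PA Wj) transv_fixv //; apply: erow_ecol0; lia.
  have sa2 : colsupp (S true) i.+1 a' by rewrite -ji.
  have [|b sb [->|[_ ->]]] := colsuppS _ sa2; [lia | | exact: cW].
  have Wb : W (b + ecol i).
    by apply: (W_of kj Sj); rewrite ji; apply: colsuppD; [apply: colsuppW | apply: colsupp_ecol].
  by rewrite -(addmKr (ecol i) b); apply: (commute_tauD Wb Wi ); [exact: cW | exact: ci].
move=> Wa; have sa : colsupp (S true) j.+1 a by rewrite -kj.
have [|b sb [->|[_ ->]]] := colsuppS _ sa; [lia | exact: c1|].
by apply: commute_tauD => //; [apply: W_of kj Sj sb | apply: c1].
Qed.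

(** If a' has entry 1 at k-1, it is the image of e_{k-1} under an element of P_{k-1}, which
    transports [sig_commute_ecol]. Otherwise a' is a sum of two such vectors and [sigD] applies. *)
Lemma sig_commute a a' : W a -> W a' -> commute (tau a) (sig a').
Proof.
move=> Wa Wa'; case: (W_cases Wa') => [->|[j kj Sj]].
  by rewrite /sig tau0 mul1g mulg1 -expg2 xk2; exact: commute1.
have Wj := W_ecol kj Sj; have jk : (j < k)%N by lia.
have c1 b c : colsupp (S true) j b -> W c -> commute (tau c) (sig (b + ecol j)).
  move=> sb Wc; have PA : inc_group S j (transv b (erow j)) by apply: inc_group_transv_col.
  have bb : erow j *m b = 0 by apply: colsupp_erow0 sb _.
  have Wc' : W (transv b (erow j) *m c) by apply: W_mul PA Wc.
  apply: (@commute_conj _ (phi (transv b (erow j))) _ _ _ _ _ _ (sig_commute_ecol kj Sj Wc')).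
    rewrite (phi_tau jk PA Wc') mulmxA (transv_inv bb) mul1mx; reflexivity.
  rewrite (phi_sig jk PA Wj) transv_mulv erow_ecol ?mulmx1 1?addrC //; lia.
have sa : colsupp (S true) j.+1 a' by rewrite -kj.
have [|b sb [->|[_ ->]]] := colsuppS _ sa; [lia | | exact: c1].
have Wb := W_of kj Sj sb.
rewrite -(addmKr (ecol j) b) sigD //; last 1 first.
- by apply: sig_commute_ecol => //; apply: colsuppD.
- apply: commuteM; [exact: sig_commute_ecol | exact: c1].
exact: colsuppD.
Qed.

Lemma sigDE a a' : W a -> W a' -> sig (a + a') = (sig a * sig a')%g.
Proof. by move=> Wa Wa'; rewrite addrC sigD //; apply: sig_commute. Qed.

Lemma sig_xk a : W a -> commute xk (sig a).
Proof. by move=> Wa; apply: word_sq_comm; [apply: tau2| |apply: sig_commute]. Qed.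

(** The coordinate at [k] decides whether [xk] occurs; in characteristic 2, adding [ecol k] removes
    that coordinate. *)
Definition colmap v := if erow k *m v == 0 then sig v else (sig (v + ecol k) * xk)%g.

Lemma colmap_W a : W a -> colmap a = sig a.
Proof. by move=> Wa; rewrite /colmap (colsupp_erow0 Wa) ?eqxx. Qed.

Lemma colmap_Wecol a : W a -> colmap (a + ecol k) = (sig a * xk)%g.
Proof.
move=> Wa; rewrite /colmap mulmxDr (colsupp_erow0 Wa) // erow_ecol; last exact: ltnW.
by rewrite add0r addmKr; case: eqP => // /mx1_neq01 [].
Qed.

Lemma sig0 : sig 0 = 1%g.
Proof. by rewrite /sig tau0 mul1g mulg1 -expg2 xk2. Qed.

Lemma colmap_ecol : colmap (ecol k) = xk.
Proof. by rewrite -[ecol k]add0r colmap_Wecol ?sig0 ?mul1g //; exact: colsupp0. Qed.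

Lemma V_cases v : V v -> exists2 a, W a & v = a \/ v = a + ecol k.
Proof.
by case/(colsuppS (ltnW kn)) => a Wa [->|[_ ->]]; exists a => //; [left|right].
Qed.

Lemma colmapD v w : V v -> V w -> colmap (v + w) = (colmap v * colmap w)%g.
Proof.
move=> /V_cases[a Wa va] /V_cases[b Wb vb].
have Wab : W (a + b) by apply: colsuppD.
have xb := sig_xk Wb; have Dab := sigDE Wa Wb.
case: va vb => -> [->|->].
- by rewrite (colmap_W Wab) (colmap_W Wa) (colmap_W Wb) Dab.
- by rewrite addrA (colmap_Wecol Wab) (colmap_W Wa) (colmap_Wecol Wb) Dab [RHS]mulgA.
- rewrite addrAC (colmap_Wecol Wab) (colmap_Wecol Wa) (colmap_W Wb) Dab.
  by move: (sig a) (sig b) xb => s t xb; rewrite -!mulgA xb.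
rewrite addrACA addmm addr0 (colmap_W Wab) (colmap_Wecol Wa) (colmap_Wecol Wb) Dab.
move: (sig a) (sig b) xb => s t xb; rewrite -!mulgA (mulgA xk) xb -!mulgA.
by rewrite -expg2 xk2 mulg1.
Qed.

Lemma phi_colmap_low j A v : (j < k)%N -> inc_group S j A -> V v ->
  (phi A * colmap v = colmap (A *m v) * phi A)%g.
Proof.
move=> jk PA /V_cases[a Wa va]; have WAa := W_mul jk PA Wa.
case: va => ->; first by rewrite (colmap_W Wa) (colmap_W WAa) (phi_sig jk PA Wa).
have Ae : A *m ecol k = ecol k by apply: (inc_group_fixv PA).
rewrite mulmxDr Ae (colmap_Wecol Wa) (colmap_Wecol WAa) mulgA (phi_sig jk PA Wa) -!mulgA.
by rewrite (xk_commute jk PA).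
Qed.

(** The only new identity is t xk = sig(e_j) xk t for t = tau(e_j), immediate from the definition of
    [sig]. *)
Lemma phi_colmap_col j v : k = j.+1 -> S true j -> V v ->
  (phi (gen_mx n true j) * colmap v = colmap (gen_mx n true j *m v) * phi (gen_mx n true j))%g.
Proof.
move=> kj Sj /V_cases[a Wa va]; have Wj := W_ecol kj Sj.
have -> : phi (gen_mx n true j) = tau (ecol j) by rewrite /tau kj.
have ta := sig_commute Wj Wa.
rewrite gen_mx_col -kj transv_mulv; case: va => ->.
  by rewrite (colsupp_erow0 Wa (leqnn k)) mulmx0 addr0 (colmap_W Wa).
rewrite mulmxDr (colsupp_erow0 Wa (leqnn k)) add0r (erow_ecol (ltnW kn)) mulmx1 addrAC.
have Waj : W (a + ecol j) by apply: colsuppD.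
rewrite (colmap_Wecol Wa) (colmap_Wecol Waj) (sigDE Wa Wj) {3}/sig.
move: (tau _) (sig a) (tau2 Wj) ta => t s t2 ts.
by rewrite mulgA ts -!mulgA (inv2K xk2) -[(t * t)%g]expg2 t2 mulg1.
Qed.

(** Here l_{k-1} fixes e_k and moves e_{k-1} to e_{k-1} + e_k. Three identities suffice: commutation
    with [xk], commutation with [sig b] for b supported below k-1, and [word_lo] for
    sig(e_{k-1}). *)
Lemma phi_colmap_row j v : k = j.+1 -> S false j -> V v ->
  (phi (gen_mx n false j) * colmap v = colmap (gen_mx n false j *m v) * phi (gen_mx n false j))%g.
Proof.
move=> kj Sj /V_cases[a Wa va].
have jk : (j < k)%N by lia.
have yE : phi (gen_mx n false j) = x false j by apply: phiX.
set y := phi _.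
have y2 : (y ^+ 2 = 1)%g by rewrite /y yE (rel_sq relx).
have yx : (y * xk = xk * y)%g.
  rewrite /y yE; apply: commE; try exact: (rel_sq relx).
  by apply: (rel_opp relx (b := false)) => //; lia.
have jn : (j <= n)%N by lia.
have erow_ek : erow j *m ecol k = 0 by apply: erow_ecol0; lia.
have erow_ke : erow k *m ecol j = 0 by apply: erow_ecol0; lia.
have PX : inc_group S k (gen_mx n false j) by apply: inc_group_gen_mx => //; exact: ltnW.
have Xv (b : cV) : gen_mx n false j *m b = b + ecol k *m (erow j *m b)
  by rewrite gen_mx_row -kj transv_mulv.
have Xek : gen_mx n false j *m ecol k = ecol k by rewrite Xv erow_ek mulmx0 addr0.
have [Sj' | nSj'] := boolP (S true j); last first.
  have a0 : a = 0 by apply: colsupp_nT nSj' _; rewrite -kj.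
  rewrite a0 add0r in va; case: va => ->.
    by rewrite mulmx0 (colmap_W (colsupp0 _ _)) sig0 mul1g mulg1.
  by rewrite Xek colmap_ecol.
have c0 b : colsupp (S true) j b -> (y * sig b = sig b * y)%g.
  move=> sb; have Wb : W b := W_of kj Sj' sb.
  have eb : erow j *m b = 0 by apply: colsupp_erow0 sb _.
  have PE : inc_group S j (transv b (erow j)) by apply: inc_group_transv_col.
  have Ek := inc_group_le (ltnW jk) PE.
  have tE := phi_tau jk PE Wb; rewrite (transv_fixv _ eb) in tE.
  have PEk : inc_group S k (transv b (erow k)) := inc_group_transv_col Wb.
  (* For matrices, conjugating [transv b (erow k)] by l_{k-1} adds [erow j] to the row; this gives
     the factor p of [word_shift]. *)
  have yt : (y * tau b = tau b * phi (transv b (erow j)) * y)%g.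
    rewrite /y /tau -(phiM PX PEk) -(phiM PEk Ek) -(phiM (inc_groupM PEk Ek) PX).
    congr phi; rewrite gen_mx_row (transv_conjI _ _ (transv_inv _)); last by apply: erow_ecol0; lia.
    rewrite -kj (transv_mulv _ _ b) eb mulmx0 addr0 mul_transvr (erow_ecol (ltnW kn)) mul1mx transvDr //.
    exact: colsupp_erow0 Wb _.
  have pp : (phi (transv b (erow j)) * phi (transv b (erow j)) = 1)%g.
    by rewrite -(phiM Ek Ek) (transv_inv eb) (hom_mx1 phiM).
  exact: (word_shift yt tE (xk_commute jk PE) yx pp).
have Wj := W_ecol kj Sj'.
have c1 b : colsupp (S true) j b -> (y * sig (b + ecol j) = sig (b + ecol j) * xk * y)%g.
  move=> sb; have Wb : W b := W_of kj Sj' sb.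
  have c2 : (y * sig (ecol j) = sig (ecol j) * xk * y)%g.
    rewrite /sig (tau_ecol kj Sj') /y yE; apply: word_lo; rewrite ?(rel_sq relx) //.
    - by rewrite -yE -/y yx.
    - exact: (rel_same relx (b := true)).
    - by rewrite /xk kj; apply: (rel_lo relx (b := true)); rewrite -?kj.
    by rewrite /xk kj; apply: (rel_adj relx (b := true)); rewrite -?kj.
  rewrite (sigDE Wb Wj); move: (sig b) (sig (ecol j)) (c0 b sb) c2 => s t c c2.
  by rewrite mulgA c -mulgA c2 !mulgA.
have sa : colsupp (S true) j.+1 a by rewrite -kj.
have [//|b sb ab] := colsuppS _ sa.
have eb : erow j *m b = 0 by apply: colsupp_erow0 sb _.
have Wb : W b := W_of kj Sj' sb.
case: ab => [ab|[_ ab]].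
  rewrite ab in va; have Xb : gen_mx n false j *m b = b by rewrite Xv eb mulmx0 addr0.
  case: va => ->; rewrite ?mulmxDr Xb ?Xek.
    by rewrite (colmap_W Wb) c0.
  by rewrite (colmap_Wecol Wb) mulgA (c0 b sb) -!(mulgA (sig b)) yx.
have Wbj : W (b + ecol j) by apply: colsuppD.
rewrite ab in va; have Xb : gen_mx n false j *m (b + ecol j) = b + ecol j + ecol k.
  by rewrite Xv mulmxDr eb add0r erow_ecol // mulmx1.
case: va => ->; rewrite ?[_ *m (_ + ecol k)]mulmxDr Xb ?Xek ?addmKr.
  by rewrite (colmap_W Wbj) (colmap_Wecol Wbj) c1.
rewrite (colmap_Wecol Wbj) (colmap_W Wbj); move: (sig _) (c1 b sb) => s c1'.
by rewrite mulgA c1' -!mulgA yx (inv2K xk2).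
Qed.

Lemma phi_colmap A v : inc_group S k A -> V v -> (phi A * colmap v = colmap (A *m v) * phi A)%g.
Proof.
move=> PA Vv.
suff [_ HA] : inc_group S k A /\ forall v, V v -> (phi A * colmap v = colmap (A *m
  v) * phi A)%g by apply: HA.
move: A PA {v Vv}; apply: inc_group_gen => //; first exact: ltnW.
- by split=> [|v Vv]; [exact: inc_group1 | rewrite (hom_mx1 phiM) mul1mx mul1g mulg1].
- move=> A B [PA HA] [PB HB]; split=> [|v Vv]; first exact: inc_groupM.
  by rewrite phiM // -mulgA HB // mulgA HA -?mulgA ?mulmxA //; apply: colsupp_mul.
move=> b i ik Sbi; have PX : inc_group S k (gen_mx n b i) by apply: inc_group_gen_mx => //;
  exact: ltnW.
split=> // v Vv; case: (ltnP i.+1 k) => ik'.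
  by apply: (phi_colmap_low ik') => //; apply: inc_group_gen_mx => //; lia.
have ki : k = i.+1 by lia.
by case: b Sbi {PX} => Si; [apply: phi_colmap_col | apply: phi_colmap_row].
Qed.

End ColumnMap.

(** * Existence of the column and row maps, duality *)

Section Universal.
Local Open Scope ring_scope.
Variables (n : nat) (G : groupType) (k : nat).
Notation M := 'M['F_2]_n.+1.
Notation cV := 'cV['F_2]_n.+1.
Notation rV := 'rV['F_2]_n.+1.
Notation ecol := (ecol n).
Notation erow := (erow n).
Implicit Types (S : bool -> nat -> bool) (x : bool -> nat -> G) (phi : M -> G).
Implicit Types (psi : cV -> G) (rho : rV -> G) (A : M) (v : cV) (q : rV).
Hypothesis kn : (k < n)%N.

Definition is_hom S x phi :=
  (forall A B, inc_group S k A -> inc_group S k B -> phi (A *m B) = (phi A * phi B)%g) /\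
  (forall b i, (i < k)%N -> S b i -> phi (gen_mx n b i) = x b i).

Definition is_col S x phi psi :=
  [/\ forall v w, colsupp (S true) k.+1 v -> colsupp (S true) k.+1 w ->
        psi (v + w) = (psi v * psi w)%g,
      forall A v, inc_group S k A -> colsupp (S true) k.+1 v ->
        (phi A * psi v = psi (A *m v) * phi A)%g &
      S true k -> psi (ecol k) = x true k].

Definition is_row S x phi rho :=
  [/\ forall q r, rowsupp (S false) k.+1 q -> rowsupp (S false) k.+1 r ->
        rho (q + r) = (rho q * rho r)%g,
      forall A q, inc_group S k A -> rowsupp (S false) k.+1 q ->
        (rho q * phi A = phi A * rho (q *m A))%g &
      S false k -> rho (erow k) = x false k].

(** Inverse transposition is multiplicative and exchanges the two families of generators; composing
    with it turns column maps into row maps. *)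
Definition dual phi A := phi (invmx A)^T.

Lemma inc_group_dual S A : inc_group (swap S) k A -> inc_group S k (invmx A)^T.
Proof. by move=> PA; apply/inc_group_trV/inc_groupV. Qed.

Lemma gen_mx_inv b i : invmx (gen_mx n b i) = gen_mx n b i.
Proof.
have XX : gen_mx n b i *m gen_mx n b i = 1%:M.
  by case: b; rewrite /gen_mx; apply: transv_inv; apply: erow_ecol0; lia.
have [uX _] := mulmx1_unit XX.
by rewrite -[LHS]mulmx1 -XX mulKmx.
Qed.

Lemma is_hom_dual S x phi : is_hom S x phi -> is_hom (swap S) (swap x) (dual phi).
Proof.
move=> [phiM phiX]; split=> [A B PA PB|b i ik Sbi].
  have [uA _] := PA; have [uB _] := PB.
  have -> : dual phi (A *m B) = phi ((invmx A)^T *m (invmx B)^T).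
    rewrite /dual -trmx_mul; congr (phi _^T).
    have uAB : A *m B \in unitmx by rewrite unitmx_mul uA.
    apply: (can_inj (mulKmx uAB)); rewrite mulmxV // mulmxA -(mulmxA A) mulmxV //.
    by rewrite mulmx1 mulmxV.
  by apply: phiM; apply: inc_group_dual.
by rewrite /dual gen_mx_inv gen_mx_tr; apply: phiX.
Qed.

Lemma col_row S x phi psi : is_col (swap S) (swap x) (dual phi) psi ->
  is_row S x phi (fun q => psi q^T).
Proof.
move=> [psiD phi_psi psi_ev]; split=> [q r Rq Rr|A q PA Rq|Sk].
- by rewrite linearD; apply: psiD.
- have PAT : inc_group (swap S) k (invmx A)^T by apply/inc_group_tr/inc_groupV.
  have RqA : colsupp (swap S true) k.+1 (q *m A)^T by apply: rowsupp_mul.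
  have [uA _] := PA.
  have E : (invmx A)^T *m (q *m A)^T = q^T by rewrite -trmx_mul mulmxK.
  have E2 : dual phi (invmx A)^T = phi A by rewrite /dual -trmx_inv trmxK invmxK.
  by have := phi_psi _ _ PAT RqA; rewrite E E2.
by rewrite erow_tr; apply: psi_ev.
Qed.

Lemma row_col S x phi rho : is_row S x phi rho ->
  is_col (swap S) (swap x) (dual phi) (fun v => rho v^T).
Proof.
move=> [rhoD phi_rho rho_er]; split=> [v w Vv Vw|A v PA Vv|Sk].
- by rewrite linearD; apply: rhoD; rewrite /rowsupp trmxK.
- have PAT : inc_group S k (invmx A)^T by apply: inc_group_dual.
  have RAv : rowsupp (S false) k.+1 (A *m v)^T.
    by rewrite /rowsupp trmxK; apply: (colsupp_mul PA).
  have [uA _] := PA.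
  have E : (A *m v)^T *m (invmx A)^T = v^T by rewrite -trmx_mul mulKmx.
  by rewrite (phi_rho _ _ PAT RAv) E.
exact: rho_er.
Qed.

Lemma col_row_dual S x phi psi : is_col S x phi psi ->
  is_row (swap S) (swap x) (dual phi) (fun q => psi q^T).
Proof.
move=> [psiD phi_psi psi_ev]; split=> [q r Rq Rr|A q PA Rq|Sk].
- by rewrite linearD; apply: psiD.
- have PAT : inc_group S k (invmx A)^T by apply: inc_group_dual.
  have RqA : colsupp (S true) k.+1 (q *m A)^T by apply: (@rowsupp_mul _ (swap S)).
  have [uA _] := PA.
  have E : (invmx A)^T *m (q *m A)^T = q^T by rewrite -trmx_mul mulmxK.
  by have := phi_psi _ _ PAT RqA; rewrite E.
by rewrite erow_tr; apply: psi_ev.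
Qed.

Lemma col_exists S x phi : coxeter_rels S x -> is_hom S x phi ->
  exists psi, is_col S x phi psi.
Proof.
move=> relx [phiM phiX]; have [Sk|nSk] := boolP (S true k).
  exists (colmap k x phi); split.
  - by move=> v w; apply: (colmapD kn Sk relx phiM phiX).
  - by move=> A v; apply: (phi_colmap kn Sk relx phiM phiX).
  by move=> _; apply: (colmap_ecol kn Sk relx phiM).
exists (fun=> 1%g); split=> [||Sk]; last by rewrite Sk in nSk.
  by move=> *; rewrite mulg1.
by move=> *; rewrite mulg1 mul1g.
Qed.

Lemma row_exists S x phi : coxeter_rels S x -> is_hom S x phi ->
  exists rho, is_row S x phi rho.
Proof.
move=> relx homx.
have [psi psiP] := col_exists (rels_swap relx) (is_hom_dual homx).
by exists (fun q => psi q^T); apply: col_row.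
Qed.

(** * The commutation rule between row and column maps *)

Section Commutation.
Variables (S : bool -> nat -> bool) (x : bool -> nat -> G) (phi : M -> G).
Variables (psi : cV -> G) (rho : rV -> G).
Hypothesis relx : coxeter_rels S x.
Hypothesis homx : is_hom S x phi.
Hypothesis colx : is_col S x phi psi.
Hypothesis rowx : is_row S x phi rho.
Let phiM := proj1 homx.
Let phiX := proj2 homx.
Let psiD := let: And3 h _ _ := colx in h.
Let phi_psi := let: And3 _ h _ := colx in h.
Let psi_ev := let: And3 _ _ h := colx in h.
Let rhoD := let: And3 h _ _ := rowx in h.
Let phi_rho := let: And3 _ h _ := rowx in h.
Let rho_er := let: And3 _ _ h := rowx in h.
Notation V := (colsupp (S true) k.+1).
Notation R := (rowsupp (S false) k.+1).

Definition comm_rel q v := (rho q * psi v = psi v * phi (transv v q) * rho q)%g.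

(** Since q v = 0, rho(q) commutes with phi([transv v r]), so the two relations can be applied one
    after the other. *)
Lemma comm_sumr q r v : R q -> R r -> V v -> q *m v = 0 -> r *m v = 0 ->
  comm_rel q v -> comm_rel r v -> comm_rel (q + r) v.
Proof.
move=> Rq Rr Vv qv rv Kq Kr; have Pq := inc_group_transvk Rq Vv qv; have Pr :=
  inc_group_transvk Rr Vv rv.
rewrite /comm_rel (rhoD Rq Rr) -(transvDr _ qv) (phiM Pq Pr).
rewrite -mulgA Kr !mulgA Kq -(mulgA _ (rho q) (phi (transv v r))) (phi_rho Pr Rq).
by rewrite (transv_fixr _ qv) !mulgA.
Qed.

Lemma comm_suml q v w : R q -> V v -> V w -> q *m v = 0 -> q *m w = 0 ->
  comm_rel q v -> comm_rel q w -> comm_rel q (v + w).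
Proof.
move=> Rq Vv Vw qv qw Kv Kw; have Pv := inc_group_transvk Rq Vv qv; have Pw :=
  inc_group_transvk Rq Vw qw.
rewrite /comm_rel (psiD Vv Vw) -(transvDl _ qw) (phiM Pv Pw).
rewrite mulgA Kv -mulgA Kw !mulgA -(mulgA _ (phi (transv v q)) (psi w)) (phi_psi Pv Vw).
by rewrite (transv_fixv _ qw) !mulgA.
Qed.

(** Conjugation by phi(A) carries one relation to the other, which spreads the relation over orbits
    of P_k. *)
Lemma comm_conj A q v : inc_group S k A -> R q -> V v -> q *m (A *m v) = 0 ->
  comm_rel (q *m A) v <-> comm_rel q (A *m v).
Proof.
move=> PA Rq Vv qAv; have [uA _] := PA.
have RqA : R (q *m A) by apply: RM.
have VAv : V (A *m v) by apply: colsupp_mul.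
have PE1 : inc_group S k (transv (A *m v) q) by apply: inc_group_transvk.
have PE2 : inc_group S k (transv v (q *m A)) by apply: inc_group_transvk => //; rewrite -mulmxA.
have E : (phi A * phi (transv v (q *m A)) = phi (transv (A *m v) q) * phi A)%g.
  by rewrite -(phiM PA PE2) -(phiM PE1 PA) (transv_conj _ _ uA) mulmxK.
have F1 : (phi A * (rho (q *m A) * psi v) = rho q * psi (A *m v) * phi A)%g.
  by rewrite mulgA -(phi_rho PA Rq) -mulgA (phi_psi PA Vv) mulgA.
have F2 : (phi A * (psi v * phi (transv v (q *m A)) * rho (q *m A)) =
           psi (A *m v) * phi (transv (A *m v) q) * rho q * phi A)%g.
  by rewrite !mulgA (phi_psi PA Vv) -(mulgA _ (phi A)) E -!mulgA (phi_rho PA Rq).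
rewrite /comm_rel; split=> H.
  by apply: (mulIg (phi A)); rewrite -F1 -F2 H.
by apply: (mulgI (phi A)); rewrite F1 F2 H.
Qed.

Lemma hom_psi0 : psi 0 = 1%g. Proof. exact: col_hom0 psiD. Qed.
Lemma hom_rho0 : rho 0 = 1%g. Proof. exact: row_hom0 rhoD. Qed.

Lemma comm_0l v : comm_rel 0 v.
Proof. by rewrite /comm_rel hom_rho0 transv0r (hom_mx1 phiM) !mulg1 mul1g. Qed.

Lemma comm_0r q : comm_rel q 0.
Proof. by rewrite /comm_rel hom_psi0 transv0l (hom_mx1 phiM) !mulg1 mul1g. Qed.

(** Equivariance of [rho] under l_{k-1} identifies rho(e_{k-1}^T) with the square of l_{k-1} l_k;
    the claim is then [word_hi]. *)
Lemma comm_base j : k = j.+1 -> S true k -> S false k -> S false j ->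
  comm_rel (erow j) (ecol k).
Proof.
move=> kj Sk Sk' Sj; have jk : (j < k)%N by lia.
have PX : inc_group S k (gen_mx n false j) by apply: inc_group_gen_mx => //; exact: ltnW.
have Re : R (erow k) by apply: rowsupp_erow.
have Rj : R (erow j) by rewrite /rowsupp erow_tr; apply: colsuppW => //; rewrite kj;
  apply: colsupp_ecol.
have y2 : (x false k ^+ 2 = 1)%g by exact: (rel_sq relx).
have z2 : (x false j ^+ 2 = 1)%g by exact: (rel_sq relx).
have ekX : erow k *m gen_mx n false j = erow j + erow k.
  rewrite gen_mx_row -kj mul_transvr (erow_ecol (ltnW kn)) mul1mx addrC; reflexivity.
have rj : rho (erow j) = (x false j * x false k * x false j * x false k)%g.
  have := phi_rho PX Re; rewrite ekX (rhoD Rj Re) (rho_er Sk') (phiX jk Sj) => E.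
  apply: (mulgI (x false j)); apply: (mulIg (x false k)).
  by rewrite -mulgA -E -!mulgA (inv2K z2) -expg2 y2 mulg1.
have XE : phi (transv (ecol k) (erow j)) = x false j by rewrite -(phiX jk Sj) gen_mx_row kj.
rewrite /comm_rel rj (psi_ev Sk) XE; apply: word_hi => //.
- exact: (rel_sq relx).
- by apply: commE; [exact: (rel_sq relx)..| apply: (rel_opp relx (b := true)) => //; lia].
- exact: (rel_same relx (b := true)).
- by rewrite kj; apply: (rel_adj relx); rewrite -?kj.
by rewrite kj; apply: (rel_hi relx (b := false)); rewrite -?kj.
Qed.

Lemma colsupp_0 T v : colsupp T 0 v -> v = 0.
Proof.
move=> sv; apply/matrixP=> i l; rewrite ord1 mxE; apply/eqP.
by apply: contraTT isT => /sv [].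
Qed.

(** Start from [comm_base]. The transvections [transv (ecol j) b] fix e_k and move e_{k-1}^T to b +
    e_{k-1}^T; sums supply the rows with entry 0 at k-1. *)
Lemma comm_ecol q : S true k -> S false k -> rowsupp (S false) k q -> comm_rel q (ecol k).
Proof.
move=> Sk Sk'; have Ve : V (ecol k) by apply: colsupp_ecol.
case: (posnP k) => [k0|k0 Rq].
  by rewrite k0 => /colsupp_0 q0; rewrite -[q]trmxK q0 trmx0; apply: comm_0l.
have [j kj] : exists j, k = j.+1 by exists k.-1; rewrite prednK.
have Rq' : colsupp (S false) j.+1 q^T by rewrite -kj.
have [Sj|nSj] := boolP (S false j); last first.
  by rewrite -[q]trmxK (colsupp_nT nSj Rq') trmx0; apply: comm_0l.
have jk : (j < k)%N by lia.
have RW b : rowsupp (S false) j b -> R b.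
  by move=> Rb; rewrite /rowsupp; apply: colsuppW => //; rewrite kj; apply: colsuppW.
have Rj : R (erow j) by rewrite /rowsupp erow_tr; apply: colsuppW => //; rewrite kj;
  apply: colsupp_ecol.
have je : erow j *m ecol k = 0 by apply: erow_ecol0; lia.
have c1 b : rowsupp (S false) j b -> comm_rel (b + erow j) (ecol k).
  move=> Rb; have PA : inc_group S j (transv (ecol j) b) by apply: inc_group_transv_row.
  have PAk : inc_group S k (transv (ecol j) b) by apply: inc_group_le PA; lia.
  have Ae : transv (ecol j) b *m ecol k = ecol k by apply: (inc_group_fixv PA).
  have -> : b + erow j = erow j *m transv (ecol j) b
    by rewrite mul_transvr erow_ecol ?mul1mx 1?addrC //; lia.
  apply/(comm_conj PAk Rj Ve); rewrite Ae //.
  exact: comm_base.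
have [|b sb qb] := colsuppS _ Rq'; first by lia.
have Rb : rowsupp (S false) j b^T by rewrite /rowsupp trmxK.
have qE : q = b^T \/ q = b^T + erow j.
  by case: qb => [|[_]] E; [left|right]; rewrite -[q]trmxK E ?linearD.
case: qE => ->; last exact: c1.
have be : b^T *m ecol k = 0 by apply: (rowsupp_erow0 Rb); lia.
rewrite -(addmKr (erow j) b^T); apply: comm_sumr => //.
- by apply: rowsuppD => //; exact: RW.
- by rewrite mulmxDl be je addr0.
- exact: c1.
exact: comm_base.
Qed.

(** The matrix [transv a (erow k)] carries e_k to a + e_k. Multiplied by it, q becomes a row that
    vanishes on e_k and so is supported below [k]. *)
Lemma comm_chart q a : S true k -> S false k -> R q -> colsupp (S true) k a ->
  q *m (a + ecol k) = 0 -> comm_rel q (a + ecol k).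
Proof.
move=> Sk Sk' Rq Wa q0; have PA : inc_group S k (transv a (erow k)) by apply: inc_group_transv_col.
have Ve : V (ecol k) by apply: colsupp_ecol.
have E : a + ecol k = transv a (erow k) *m ecol k
  by rewrite transv_mulv (erow_ecol (ltnW kn)) mulmx1 addrC.
rewrite E in q0 *; apply/(comm_conj PA Rq Ve q0).
apply: comm_ecol => //.
have RqA : R (q *m transv a (erow k)) by apply: RM.
have [|b sb [bE|[_ bE]]] := colsuppS _ RqA; first exact: ltnW.
  by rewrite /rowsupp bE.
case: (@mx1_neq01); rewrite -q0 mulmxA -[q *m transv _ _]trmxK bE linearD /= mulmxDl.
rewrite (@rowsupp_erow0 _ (S false) k) ?trmxK // add0r ecol_tr erow_ecol //; exact: ltnW.
Qed.

End Commutation.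

(** As q v = 0, the transvection is an involution, so [dual] only transposes it. Its image commutes
    with rho(q) and psi(v), which allows the dual relation to be reversed. *)
Lemma comm_dual S x phi psi rho q v : is_hom S x phi -> is_col S x phi psi ->
  is_row S x phi rho -> rowsupp (S false) k.+1 q -> colsupp (S true) k.+1 v -> q *m v = 0 ->
  comm_rel (dual phi) (fun v => rho v^T) (fun q => psi q^T) v^T q^T ->
  comm_rel phi psi rho q v.
Proof.
move=> [phiM _] [psiD phi_psi _] [rhoD phi_rho _] Rq Vv qv; rewrite /comm_rel !trmxK.
have E : dual phi (transv q^T v^T) = phi (transv v q).
  rewrite /dual; congr phi; rewrite -[RHS]trmxK; congr (_^T).
  rewrite transv_tr; have EE : transv q^T v^T *m transv q^T v^T = 1%:M.
    by apply: transv_inv; rewrite -trmx_mul qv trmx0.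
  have [uE _] := mulmx1_unit EE.
  by rewrite -[LHS]mulmx1 -EE mulKmx.
rewrite E => K; have PE := inc_group_transvk Rq Vv qv.
have E2 : (phi (transv v q) * phi (transv v q) = 1)%g
  by rewrite -(phiM _ _ PE PE) (transv_inv qv) (hom_mx1 phiM).
have := phi_rho _ _ PE Rq; rewrite (transv_fixr _ qv) => K2.
have := phi_psi _ _ PE Vv; rewrite (transv_fixv _ qv) => K3.
rewrite -K3 -mulgA K K2 !mulgA E2 mul1g; reflexivity.
Qed.

(** [comm_chart] covers v with entry 1 at [k], and its dual covers q with entry 1 at [k]. If both
    entries are 0, v is the sum of v + e_k and e_k, both covered by the chart. *)
Lemma comm_all S x phi psi rho : coxeter_rels S x -> is_hom S x phi ->
  is_col S x phi psi -> is_row S x phi rho -> forall q v,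
  rowsupp (S false) k.+1 q -> colsupp (S true) k.+1 v -> q *m v = 0 ->
  comm_rel phi psi rho q v.
Proof.
move=> relx homx colx rowx q v Rq Vv qv.
have [Sk|nSk] := boolP (S true k); last first.
  by rewrite (colsupp_nT nSk Vv); apply: comm_0r homx colx _.
have [Sk'|nSk] := boolP (S false k); last first.
  by rewrite -[q]trmxK (colsupp_nT nSk Rq) trmx0; apply: comm_0l homx rowx _.
have Ve : colsupp (S true) k.+1 (ecol k) by apply: colsupp_ecol.
have chart := comm_chart relx homx colx rowx Sk Sk' Rq.
have [|a Wa [va|[_ va]]] := colsuppS _ Vv; [exact: ltnW| |by rewrite va in qv *; apply: chart].
have [|b Wb [qb|[_ qb]]] := colsuppS _ Rq; first exact: ltnW.
  have qe : q *m ecol k = 0 by rewrite -[q]trmxK qb; apply: (@rowsupp_erow0 _ (S false) k);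
    rewrite ?trmxK.
  have qa : q *m a = 0 by rewrite -va.
  have Va : colsupp (S true) k.+1 a by apply: colsuppW.
  rewrite va -(addmKr (ecol k) a).
  have qae : q *m (a + ecol k) = 0 by rewrite mulmxDr qe qa addr0.
  apply: (comm_suml homx colx Rq _ Ve qae qe); [exact: colsuppD | exact: chart |].
  by rewrite -[ecol k]add0r; apply: chart; rewrite ?add0r //; exact: colsupp0.
apply: (comm_dual homx colx rowx Rq Vv qv).
rewrite qb; apply: (comm_chart (rels_swap relx) (is_hom_dual homx)
  (row_col rowx) (col_row_dual colx)) => //.
- by rewrite /rowsupp trmxK.
by rewrite -qb -trmx_mul qv trmx0.
Qed.

(** Such a row is e_k^T A for a transvection A in P_k that fixes e_k; conjugation by phi(A) reduces
    to (u_k l_k)^3 = 1. *)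
Lemma braid_all S x phi psi rho : coxeter_rels S x -> is_hom S x phi ->
  is_col S x phi psi -> is_row S x phi rho -> forall q, S true k -> S false k ->
  rowsupp (S false) k.+1 q -> q *m ecol k = 1%:M ->
  (psi (ecol k) * rho q * psi (ecol k) = rho q * psi (ecol k) * rho q)%g.
Proof.
move=> relx [phiM phiX] [psiD phi_psi psi_ev] [rhoD phi_rho rho_er] q Sk Sk' Rq qe.
have [|b Wb [qb|[_ qb]]] := colsuppS _ Rq; first exact: ltnW.
  case: (@mx1_neq01); rewrite -qe -[q]trmxK qb.
  by rewrite (@rowsupp_erow0 _ (S false) k k) ?trmxK.
have qE : q = erow k + b^T by rewrite -[q]trmxK qb linearD /= ecol_tr addrC.
have Wb' : rowsupp (S false) k b^T by rewrite /rowsupp trmxK.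
have be : b^T *m ecol k = 0 by apply: (rowsupp_erow0 Wb').
pose A := transv (ecol k) b^T; have PA : inc_group S k A by apply: inc_group_transv_row.
have Re : rowsupp (S false) k.+1 (erow k) by apply: rowsupp_erow.
have Ve : colsupp (S true) k.+1 (ecol k) by apply: colsupp_ecol.
have eA : erow k *m A = q by rewrite /A mul_transvr (erow_ecol (ltnW kn)) mul1mx qE.
have Ae : A *m ecol k = ecol k by rewrite /A (transv_fixv _ be).
have H1 := phi_rho _ _ PA Re; have H2 := phi_psi _ _ PA Ve.
rewrite eA (rho_er Sk') in H1; rewrite Ae in H2.
have br := braidE (rel_sq relx Sk) (rel_sq relx Sk') (rel_same relx (b := true) Sk Sk').
rewrite -(psi_ev Sk) /= in br.
move: (phi A) (rho q) (psi (ecol k)) (x false k) H1 H2 br => g r p y H1 H2 br.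
apply: (mulgI g).
have -> : (g * (p * r * p) = p * y * p * g)%g.
  by rewrite !mulgA H2 -(mulgA p) -H1 mulgA -(mulgA _ g) H2 mulgA.
by rewrite br !mulgA -H1 -(mulgA y g) H2 !mulgA -(mulgA _ g) -H1 mulgA.
Qed.

End Universal.

Theorem incidence_universal n (G : groupType) S (x : bool -> nat -> G) k : coxeter_rels S x ->
  (k <= n)%N -> exists phi : 'M['F_2]_n.+1 -> G, is_hom k S x phi.
Proof.
move=> relx; elim: k => [|k IH] kn.
  exists (fun=> 1%g); split=> [A B _ _|b i]; last by rewrite ltn0.
  by rewrite mulg1.
have [phi homx] := IH (ltnW kn).
have [psi colx] := col_exists kn relx homx; have [rho rowx] := row_exists kn relx homx.
have K := comm_all kn relx homx colx rowx.
have br := braid_all kn relx homx colx rowx.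
have [phiM phiX] := homx; have [psiD phi_psi psi_ev] := colx.
have [rhoD phi_rho rho_er] := rowx.
have [phi' [phiM' phi'E phi't phi'f]] :=
  hom_extend kn phiM psiD rhoD phi_psi phi_rho K br.
exists phi'; split=> // b i; rewrite ltnS leq_eqVlt => /orP[/eqP->|ik] Sbi.
  by case: b Sbi => Sk; rewrite ?phi't ?phi'f ?psi_ev ?rho_er.
by rewrite phi'E ?phiX //; apply: inc_group_gen_mx => //; exact: ltnW.
Qed.

(** * The Coxeter relations between transvections *)

Section MatrixRelations.
Local Open Scope ring_scope.
Variable n : nat.
Notation M := 'M['F_2]_n.+1.
Notation cV := 'cV['F_2]_n.+1.
Notation ecol := (ecol n).
Notation erow := (erow n).
Notation gen_mx := (gen_mx n).

Lemma gen_mx_involutive b i : gen_mx b i *m gen_mx b i = 1%:M.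
Proof. by case: b; rewrite /gen_mx; apply: transv_inv; apply: erow_ecol0; lia. Qed.

Lemma gen_mx_unit b i : gen_mx b i \is a GRing.unit.
Proof. by have [uX _] := mulmx1_unit (gen_mx_involutive b i); exact: uX. Qed.

Definition gen_GL (b : bool) (i : nat) : {'GL_n.+1['F_2]} :=
  FinRing.unit 'M['F_2]_n.+1 (gen_mx_unit b i).

Lemma gen_GLE b i : GLval (gen_GL b i) = gen_mx b i. Proof. by []. Qed.

(** Boolean coordinates on four consecutive basis vectors, enough for words in three consecutive
    generators. Vectors of index above [n] are zero, so a window may overhang the matrix. *)
Definition win (i : nat) (a b c d : bool) : cV :=
  ecol i *+ a + ecol i.+1 *+ b + ecol i.+2 *+ c + ecol i.+3 *+ d.

Lemma mulrb_addb (v : cV) (a b : bool) : v *+ a + v *+ b = v *+ (a (+) b).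
Proof. by case: a; case: b; rewrite /= ?addr0 ?add0r // addmm. Qed.

Lemma gen_mxt_ecol i m : (i < n)%N -> gen_mx true i *m ecol m = ecol m + ecol i *+ (m == i.+1).
Proof.
move=> lin; rewrite gen_mx_col transv_mulv; case: eqP => [->|/eqP mi].
  by rewrite erow_ecol // mulmx1.
by rewrite erow_ecol0 ?mulmx0 //; apply/eqP; rewrite eq_sym.
Qed.

Lemma gen_mxf_ecol i m : (i < n)%N -> gen_mx false i *m ecol m = ecol m + ecol i.+1 *+ (m == i).
Proof.
move=> lin; rewrite gen_mx_row transv_mulv; case: eqP => [->|/eqP mi].
  by rewrite erow_ecol ?mulmx1 // ltnW.
by rewrite erow_ecol0 ?mulmx0 //; apply/eqP; rewrite eq_sym.
Qed.

Lemma gen_mx_ecolF b i m : (i < n)%N -> m != i -> m != i.+1 -> gen_mx b i *m ecol m = ecol m.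
Proof.
move=> lin mi mi1; case: b; first by rewrite gen_mxt_ecol // (negbTE mi1) addr0.
by rewrite gen_mxf_ecol // (negbTE mi) addr0.
Qed.

Lemma eq_far i : (((i == i.+1) = false) * ((i == i.+2) = false) * ((i == i.+3) = false) *
  ((i.+1 == i) = false) * ((i.+2 == i) = false) * ((i.+3 == i) = false) *
  ((i == i.+4) = false) * ((i.+4 == i) = false))%type.
Proof. by do !split; apply/eqP; lia. Qed.

Lemma gen_mxt_ecolb i m (e : bool) : (i < n)%N ->
  gen_mx true i *m (ecol m *+ e) = ecol m *+ e + ecol i *+ (e && (m == i.+1)).
Proof. by case: e => lin; rewrite ?mulmx0 ?addr0 //= gen_mxt_ecol. Qed.

Lemma gen_mxf_ecolb i m (e : bool) : (i < n)%N ->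
  gen_mx false i *m (ecol m *+ e) = ecol m *+ e + ecol i.+1 *+ (e && (m == i)).
Proof. by case: e => lin; rewrite ?mulmx0 ?addr0 //= gen_mxf_ecol. Qed.

Lemma gen_mxt_win0 i a b c d : (i < n)%N -> gen_mx true i *m win i a b c d = win i (a (+) b) b c d.
Proof.
move=> lin; rewrite /win !mulmxDr !gen_mxt_ecolb // ?eqSS !eq_far eqxx !andbF andbT !addr0.
by rewrite -mulrb_addb -!addrA; congr (_ + _); rewrite addrCA !addrA.
Qed.

Lemma gen_mxt_win1 i a b c d : (i.+1 < n)%N -> gen_mx true i.+1 *m win i a b c d =
  win i a (b (+) c) c d.
Proof.
move=> lin; rewrite /win !mulmxDr !gen_mxt_ecolb // ?eqSS !eq_far eqxx !andbF andbT !addr0.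
by rewrite -mulrb_addb -!addrA; do 2 congr (_ + _); rewrite addrCA !addrA.
Qed.

Lemma gen_mxt_win2 i a b c d : (i.+2 < n)%N -> gen_mx true i.+2 *m win i a b c d =
  win i a b (c (+) d) d.
Proof.
move=> lin; rewrite /win !mulmxDr !gen_mxt_ecolb // ?eqSS !eq_far eqxx !andbF andbT !addr0.
by rewrite -mulrb_addb -!addrA; do 3 congr (_ + _); rewrite addrC.
Qed.

Lemma gen_mxf_win0 i a b c d : (i < n)%N -> gen_mx false i *m win i a b c d = win i a (b (+) a) c d.
Proof.
move=> lin; rewrite /win !mulmxDr !gen_mxf_ecolb // ?eqSS !eq_far eqxx !andbF andbT !addr0.
by rewrite -mulrb_addb -!addrA; congr (_ + _); rewrite addrCA.
Qed.

Lemma gen_mxf_win1 i a b c d : (i.+1 < n)%N -> gen_mx false i.+1 *m win i a b c d =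
  win i a b (c (+) b) d.
Proof.
move=> lin; rewrite /win !mulmxDr !gen_mxf_ecolb // ?eqSS !eq_far eqxx !andbF andbT !addr0.
by rewrite -mulrb_addb -!addrA; do 2 congr (_ + _); rewrite addrCA.
Qed.

Lemma gen_mxf_win2 i a b c d : (i.+2 < n)%N -> gen_mx false i.+2 *m win i a b c d =
  win i a b c (d (+) c).
Proof.
move=> lin; rewrite /win !mulmxDr !gen_mxf_ecolb // ?eqSS !eq_far eqxx !andbF andbT !addr0.
by rewrite -mulrb_addb -!addrA; do 3 congr (_ + _); rewrite addrC.
Qed.

Lemma win_id i (A : M) : (forall a b c d, A *m win i a b c d = win i a b c d) ->
  (forall m, m != i -> m != i.+1 -> m != i.+2 -> m != i.+3 -> A *m ecol m = ecol m) ->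
  A = 1%:M.
Proof.
move=> Aw Am; have Aev m : A *m ecol m = ecol m.
  have W a b c d : ecol m = win i a b c d -> A *m ecol m = ecol m by move=> ->.
  have [->|mi] := eqVneq m i.
    by rewrite -[ecol i](_ : win i true false false false = _) // /win !addr0.
  have [->|mi1] := eqVneq m i.+1.
    by rewrite -[ecol _](_ : win i false true false false = _) // /win !addr0 add0r.
  have [->|mi2] := eqVneq m i.+2.
    by rewrite -[ecol _](_ : win i false false true false = _) // /win !addr0 !add0r.
  have [->|mi3] := eqVneq m i.+3.
    by rewrite -[ecol _](_ : win i false false false true = _) // /win !add0r.
  exact: Am.
apply/matrixP=> p q; have /matrixP/(_ p 0) := Aev q.
rewrite ecol_mulE -1?ltnS // mxE inord_val => ->.
by rewrite !mxE.
Qed.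

Lemma GL_val1 (g : {'GL_n.+1['F_2]}) : GLval g = 1%:M -> g = 1%g.
Proof. by move=> g1; apply: val_inj. Qed.

Lemma commute_sq2 (G : groupType) (a b : G) : (a ^+ 2 = 1 -> b ^+ 2 = 1 ->
  a * b = b * a -> (a * b) ^+ 2 = 1)%g.
Proof.
move=> a2 b2 ab; rewrite expg2 {2}ab -!mulgA (inv2K b2).
by rewrite -expg2.
Qed.

Lemma transv_far (u v : cV) (q r : 'rV['F_2]_n.+1) : q *m v = 0 -> r *m u = 0 ->
  transv u q *m transv v r = transv v r *m transv u q.
Proof.
move=> qv ru; rewrite /transv !(mulmxDl, mulmxDr, mul1mx, mulmx1).
rewrite -!mulmxA (mulmxA q) (mulmxA r) qv ru !mul0mx !mulmx0 !addr0.
by rewrite addrAC.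
Qed.

Lemma gen_GL_sq b i : (gen_GL b i ^+ 2 = 1)%g.
Proof. by apply: GL_val1; rewrite expg2 GL_MxE gen_GLE gen_mx_involutive. Qed.

Lemma gen_GL_commute b c i j : gen_mx b i *m gen_mx c j = gen_mx c j *m gen_mx b i ->
  ((gen_GL b i * gen_GL c j) ^+ 2 = 1)%g.
Proof.
move=> XX; apply: commute_sq2; try exact: gen_GL_sq.
by apply: val_inj; rewrite /= [LHS]XX.
Qed.

(** A boolean model of the generators, indexed by family and offset in the window, so that relations
    become computations. *)
Definition win_step (p : bool * nat) (s : bool * bool * bool * bool) :=
  let: (a, b, c, d) := s in
  match p with
  | (true, 0) => (a (+) b, b, c, d)
  | (true, 1) => (a, b (+) c, c, d)
  | (true, _) => (a, b, c (+) d, d)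
  | (false, 0) => (a, b (+) a, c, d)
  | (false, 1) => (a, b, c (+) b, d)
  | (false, _) => (a, b, c, d (+) c)
  end.

Definition winp i (s : bool * bool * bool * bool) := let: (a, b, c, d) := s in win i a b c d.

Lemma gen_mx_winp i p s : (p.2 < 3)%N -> (p.2 + i < n)%N ->
  gen_mx p.1 (p.2 + i) *m winp i s = winp i (win_step p s).
Proof.
case: p s => [e j] [[[a b] c] d]; case: e; case: j => [|[|[|]]] //= _ lin.
- exact: gen_mxt_win0.
- exact: gen_mxt_win1.
- exact: gen_mxt_win2.
- exact: gen_mxf_win0.
- exact: gen_mxf_win1.
exact: gen_mxf_win2.
Qed.

(* A word in the generators of index i, i+1, i+2 is trivial as soon as it fixes
   all F_2-combinations of four consecutive basis vectors: a finite check. *)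
Lemma gen_GL_word i (l : seq (bool * nat)) :
  all (fun p => (p.2 < 3)%N && (p.2 + i < n)%N) l ->
  (forall s, foldr win_step s l = s) ->
  (foldr (fun p g => gen_GL p.1 (p.2 + i) * g) 1 l = 1)%g.
Proof.
move=> ll ls; apply: GL_val1; apply: (win_id (i := i)) => [a b c d|m m0 m1 m2 m3].
  rewrite -[RHS]/(winp i (a, b, c, d)) -[in RHS](ls (a, b, c, d)) -[win _ _ _ _ _]/(winp i (a, b, c, d)).
  elim: l ll {ls} => [|p l IH] /=; first by rewrite mul1mx.
  case/andP=> /andP[p3 pn] ll; rewrite -mulmxA; rewrite [Y in _ *m Y]IH //.
  exact: gen_mx_winp.
elim: l ll {ls} => [|p l IH] /=; first by rewrite mul1mx.
case/andP=> /andP[p3 pn] ll; rewrite -mulmxA; rewrite [Y in _ *m Y]IH //.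
by rewrite gen_mx_ecolF //; case: (p.2) p3 => [|[|[|]]].
Qed.

(** Squares and commutations are direct. Every other relation is a word in at most three consecutive
    indices, checked on the sixteen states of a window. *)
Lemma gen_GL_rels : coxeter_rels (fun _ i => i < n)%N gen_GL.
Proof.
split=> b i.
- by move=> _; exact: gen_GL_sq.
- move=> j lin jn ij; apply: gen_GL_commute; case: b; rewrite /gen_mx; apply: transv_far;
  apply: erow_ecol0; lia.
- move=> j lin jn ij; apply: gen_GL_commute; case: b; rewrite /gen_mx /=; apply: transv_far;
  apply: erow_ecol0; lia.
- move=> lin _; have := @gen_GL_word i (flatten (nseq 3 [:: (b, 0); (~~ b, 0)])).
  rewrite /= lin !expgS expg0 !mulg1 -!mulgA; apply=> //.
  by case: b => -[[[[] []] []] []].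
- move=> lin lin1; have := @gen_GL_word i (flatten (nseq 4 [:: (b, 0); (b, 1)])).
  rewrite /= lin lin1 !expgS expg0 !mulg1 -!mulgA; apply=> //.
  by case: b => -[[[[] []] []] []].
- move=> lin lin1 lin2.
  have := @gen_GL_word i (flatten (nseq 4 [:: (b, 0); (b, 1); (b, 2)])).
  rewrite /= lin lin1 lin2 !expgS expg0 !mulg1 -!mulgA; apply=> //.
  by case: b => -[[[[] []] []] []].
- move=> lin lin1 _.
  have := @gen_GL_word i (flatten (nseq 3 [:: (b, 0); (b, 1); (~~ b, 0)])).
  rewrite /= lin lin1 !expgS expg0 !mulg1 -!mulgA; apply=> //.
  by case: b => -[[[[] []] []] []].
move=> lin lin1 _.
have := @gen_GL_word i (flatten (nseq 3 [:: (b, 0); (b, 1); (~~ b, 1)])).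
rewrite /= lin lin1 !expgS expg0 !mulg1 -!mulgA; apply=> //.
by case: b => -[[[[] []] []] []].
Qed.

End MatrixRelations.

(** * The presented group *)

Section PresentedGroup.
Variables (A : Type) (R : seq (letter A) -> Prop).
Implicit Types (u v w p s : seq (letter A)).
Notation "u ~ v" := (pres_eq R u v) (at level 70).

Lemma pres_eq_ctx p s u v : u ~ v -> p ++ u ++ s ~ p ++ v ++ s.
Proof.
elim=> {u v} [w|u v _ IH|u v w _ IH1 _ IH2|u v a b|u v r Rr].
- exact: pe_refl.
- exact: pe_sym.
- exact: pe_trans IH1 IH2.
- by rewrite -!catA !(catA p u); exact: pe_cancel.
by rewrite -!catA !(catA p u); exact: pe_rel.
Qed.

Lemma pres_eq_cat u u' v v' : u ~ u' -> v ~ v' -> u ++ v ~ u' ++ v'.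
Proof.
move=> /(pres_eq_ctx [::] v) uu' /(pres_eq_ctx u' [::]); rewrite !cats0 => vv'.
exact: pe_trans uu' vv'.
Qed.

Definition word_inv w := rev [seq (l.1, ~~ l.2) | l <- w].

Lemma word_invl w : word_inv w ++ w ~ [::].
Proof.
elim: w => [|[a b] w IH]; first exact: pe_refl.
rewrite /word_inv /= rev_cons -cats1 -catA.
have := pe_cancel R (word_inv w) w a (~~ b); rewrite negbK => H.
exact: pe_trans H IH.
Qed.

Lemma word_invK : involutive word_inv.
Proof.
move=> w; rewrite /word_inv map_rev revK -map_comp -[RHS]map_id.
by apply: eq_map => -[a b] /=; rewrite negbK.
Qed.

Lemma word_invr w : w ++ word_inv w ~ [::].
Proof. by rewrite -{1}[w]word_invK; exact: word_invl. Qed.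

Lemma word_inv_eq u v : u ~ v -> word_inv u ~ word_inv v.
Proof.
move=> uv; have H1 : word_inv u ++ (v ++ word_inv v) ~ word_inv u.
  by have := pres_eq_cat (pe_refl R (word_inv u)) (word_invr v); rewrite cats0.
have H2 : word_inv u ++ (u ++ word_inv v) ~ word_inv v.
  by rewrite catA; exact: (pres_eq_cat (word_invl u) (pe_refl R (word_inv v))).
apply: pe_trans (pe_sym H1) _; apply: pe_trans _ H2.
by apply: pe_sym; apply: pres_eq_ctx.
Qed.

(** Classes are predicates on words: extensionality turns [pres_eq] into equality of classes, and
    choice supplies the representatives [class_word]. *)
Definition pres_group := {c : seq (letter A) -> Prop | exists w, c = pres_eq R w}.

Definition word_class w : pres_group :=
  exist _ (pres_eq R w) (ex_intro _ w erefl).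

Lemma word_class_eq u v : word_class u = word_class v <-> u ~ v.
Proof.
split=> [/(congr1 sval) /= -> |uv]; first exact: pe_refl.
apply: eq_exist; rewrite /=; apply/predeqP => w; split=> [uw|vw].
  exact: pe_trans (pe_sym uv) uw.
exact: pe_trans uv vw.
Qed.

Definition class_word (c : pres_group) : seq (letter A) := projT1 (cid (proj2_sig c)).

Lemma class_wordK : cancel class_word word_class.
Proof.
by case=> c wc; apply: eq_exist; rewrite /class_word; case: cid => w /= ->.
Qed.

Lemma word_classK w : class_word (word_class w) ~ w.
Proof. by apply/word_class_eq; rewrite class_wordK. Qed.

Definition pres_mul c d := word_class (class_word c ++ class_word d).
Definition pres_inv c := word_class (word_inv (class_word c)).

Lemma pres_mulE u v : pres_mul (word_class u) (word_class v) = word_class (u ++ v).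
Proof. by apply/word_class_eq; apply: pres_eq_cat; exact: word_classK. Qed.

Lemma pres_invE u : pres_inv (word_class u) = word_class (word_inv u).
Proof. by apply/word_class_eq; apply: word_inv_eq; exact: word_classK. Qed.

Lemma pres_mulA : associative pres_mul.
Proof.
move=> a b c; rewrite -[a]class_wordK -[b]class_wordK -[c]class_wordK.
by rewrite !pres_mulE catA.
Qed.

Lemma pres_mul1 : left_id (word_class [::]) pres_mul.
Proof. by move=> a; rewrite -[a]class_wordK pres_mulE. Qed.

Lemma pres_mulr1 : right_id (word_class [::]) pres_mul.
Proof. by move=> a; rewrite -[a]class_wordK pres_mulE cats0. Qed.

Lemma pres_mulV : left_inverse (word_class [::]) pres_inv pres_mul.
Proof.
move=> a; rewrite -[a]class_wordK pres_invE pres_mulE.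
by apply/word_class_eq; exact: word_invl.
Qed.

Lemma pres_mulrV : right_inverse (word_class [::]) pres_inv pres_mul.
Proof.
move=> a; rewrite -[a]class_wordK pres_invE pres_mulE.
by apply/word_class_eq; exact: word_invr.
Qed.

HB.instance Definition _ := gen_eqMixin pres_group.
HB.instance Definition _ := gen_choiceMixin pres_group.
HB.instance Definition _ := isGroup.Build pres_group
  pres_mulA pres_mul1 pres_mulr1 pres_mulV pres_mulrV.

Definition pres_gen (a : A) : pres_group := word_class [:: (a, true)].

End PresentedGroup.

Section Evaluation.
Local Open Scope group_scope.
Variables (A : Type) (G : groupType) (psi : A -> G).

(** The fold of [eval_word] over an arbitrary group, since the presented group is not known in
    advance to be finite. *)
Definition word_eval (w : seq (letter A)) : G :=
  foldr (fun l acc => (if l.2 then psi l.1 else (psi l.1)^-1) * acc) 1 w.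

Lemma word_eval_cat u v : word_eval (u ++ v) = word_eval u * word_eval v.
Proof. by elim: u => [|l u IH] /=; rewrite ?mul1g // IH mulgA. Qed.

Lemma word_eval_pow m w : word_eval (flatten (nseq m w)) = word_eval w ^+ m.
Proof. by elim: m => [|m IH] //=; rewrite word_eval_cat IH expgS. Qed.

Lemma word_eval_pres R u v : (forall r, R r -> word_eval r = 1) -> pres_eq R u v ->
  word_eval u = word_eval v.
Proof.
move=> HR; elim=> {u v} [//|//|u v w _ -> //|u v a b|u v r Rr].
  rewrite !word_eval_cat; congr (_ * _); rewrite /= mulg1.
  by case: b; rewrite /= ?mulgV ?mulVg mul1g.
by rewrite !word_eval_cat (HR _ Rr) mul1g.
Qed.

End Evaluation.

Lemma word_eval_gen (A : Type) (R : seq (letter A) -> Prop) w :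
  word_eval (pres_gen R) w = word_class R w.
Proof.
elim: w => [//|[a b] w IH] /=; rewrite IH.
case: b; first by rewrite [LHS]pres_mulE.
have -> : ((pres_gen R a)^-1 = word_class R [:: (a, false)])%g by rewrite [LHS]pres_invE.
by rewrite [LHS]pres_mulE.
Qed.

(** * Relators of the system A_{2,n} *)

Section Permutations.
Variable T : eqType.
Implicit Types a b c d e f : T.

Lemma perm_eq1 a b : perm_eq [:: a] [:: b] -> a = b.
Proof. by move/perm_mem/(_ a); rewrite !inE eqxx => /esym/eqP. Qed.

Lemma perm_eq2 a b c d : perm_eq [:: a; b] [:: c; d] -> a = c /\ b = d \/ a = d /\ b = c.
Proof.
move=> abcd; have := perm_mem abcd a; rewrite !inE eqxx => /esym/orP[/eqP ac|/eqP ad].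
  by left; move: abcd; rewrite ac perm_cons => /perm_eq1.
right; move: abcd; rewrite ad perm_sym (perm_catC [:: c] [:: d]) perm_cons.
by move/perm_eq1.
Qed.

Lemma perm_eq3 a b c d e f : perm_eq [:: a; b; c] [:: d; e; f] ->
  [\/ a = d /\ (b = e /\ c = f \/ b = f /\ c = e),
      a = e /\ (b = d /\ c = f \/ b = f /\ c = d) |
      a = f /\ (b = d /\ c = e \/ b = e /\ c = d)].
Proof.
move=> abcd; have := perm_mem abcd a; rewrite !inE eqxx => /esym/or3P[]/eqP aE.
- by constructor 1; move: abcd; rewrite aE perm_cons => /perm_eq2.
- constructor 2; move: abcd; rewrite aE perm_sym (perm_catCA [:: d] [:: e] [:: f]) perm_cons.
  by rewrite perm_sym => /perm_eq2.
constructor 3; move: abcd; rewrite aE perm_sym (perm_catC [:: d; e] [:: f]) perm_cons.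
by rewrite perm_sym => /perm_eq2.
Qed.

Variables (G : groupType) (phi : T -> G).
Local Open Scope group_scope.

Lemma pow_rot (x y : G) m : (x * y) ^+ m = 1 -> (y * x) ^+ m = 1.
Proof.
move=> xy; have -> : y * x = (x * y) ^ x by rewrite conjgE mulgA mulKg.
by rewrite -conjXg xy conj1g.
Qed.

(** Rotating the word is a conjugation, and reversing a word in involutions is an inversion;
    together they give all six orders. *)
Lemma pow_perm3 a b c d e f m :
  phi d ^+ 2 = 1 -> phi e ^+ 2 = 1 -> phi f ^+ 2 = 1 ->
  perm_eq [:: a; b; c] [:: d; e; f] ->
  (phi d * phi e * phi f) ^+ m = 1 -> (phi a * phi b * phi c) ^+ m = 1.
Proof.
move=> d2 e2 f2 abc w.
have w2 : (phi f * phi e * phi d) ^+ m = 1.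
  have -> : phi f * phi e * phi d = (phi d * phi e * phi f)^-1.
    by rewrite !invgM !inv2 // mulgA.
  by rewrite expVgn w invg1.
have rot (x y z : G) : (x * y * z) ^+ m = 1 -> (y * z * x) ^+ m = 1.
  by rewrite -mulgA => /pow_rot.
case: (perm_eq3 abc) => -[->] [] [-> ->].
- exact: w.
- exact: (rot _ _ _ (rot _ _ _ (w2))).
- exact: (rot _ _ _ w2).
- exact: (rot _ _ _ w).
- exact: (rot _ _ _ (rot _ _ _ w)).
exact: w2.
Qed.

End Permutations.

Section Relators.
Variables (n : nat) (lam mu : seq nat).

(** Indices start at 0 and stopovers at 1. The family [true] lies above the diagonal and is governed
    by [mu], whose parabolic subgroup enters transposed. *)
Definition active (b : bool) (i : nat) : bool :=
  (i < n) && (i.+1 \notin stopovers (if b then mu else lam)).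

Notation C := (cox_restr (A2 n) (S_lm n lam mu)).
Definition ckey (p : cox_X C) : nat * bool := gkey (val p).

Lemma ckey_active p : active (ckey p).2 (ckey p).1.
Proof.
case: p => -[i b] /=; rewrite /S_lm /active /ckey /gkey /= ltn_ord.
by case: b.
Qed.

Lemma ckey_inj : injective ckey.
Proof.
move=> [[i b] Sp] [[j c] Sq]; rewrite /ckey /gkey /= => -[/val_inj ij bc].
by apply: val_inj; rewrite /= ij bc.
Qed.

Lemma ckey_ex b i : active b i -> exists p, ckey p = (i, b).
Proof.
move=> /andP[lin ib].
have Sp : S_lm n lam mu (Ordinal lin, b) by rewrite /S_lm /=; case: b ib.
by exists (exist _ (Ordinal lin, b) Sp).
Qed.

Lemma A2_fE (p q : A2gen n) : A2_f p q =
  if (p.2 == q.2) && ((val q.1 == (val p.1).+1) || (val p.1 == (val q.1).+1)) then 4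
  else if (p.2 != q.2) && (val p.1 == val q.1) then 3 else 2.
Proof.
case: p q => [i b] [j c]; rewrite /A2_f /gkey /=.
have E1 : [exists k : 'I_n, (k.+1 < n) &&
    (perm_eq [:: (val i, b); (val j, c)] [:: (val k, false); (k.+1, false)]
  || perm_eq [:: (val i, b); (val j, c)] [:: (val k, true); (k.+1, true)])] =
    (b == c) && ((val j == (val i).+1) || (val i == (val j).+1)).
  apply/existsP/idP => [[k /andP[_ H]] | /andP[/eqP <-]].
    by case/orP: H => /perm_eq2[] [[/= -> ->] [-> ->]]; rewrite ?eqxx ?orbT.
  case/orP=> /eqP E; [exists i | exists j]; rewrite -E ltn_ord /=.
    by case: b; rewrite perm_refl ?orbT.
  rewrite !(perm_sym [:: (val i, b); _]) !(perm_catC [:: (val j, _)] [:: (val i, _)]).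
  by case: b; rewrite perm_refl ?orbT.
rewrite E1; case: ifP => // _.
have -> // : [exists k : 'I_n, perm_eq [:: (val i, b); (val j, c)]
     [:: (val k, false); (val k, true)]] = (b != c) && (val i == val j).
apply/existsP/idP => [[k /perm_eq2[] [[/= -> ->] [-> ->]]] | /andP[bc /eqP ij]];
  rewrite ?eqxx //.
exists i; rewrite -ij; case: b c bc {E1} => -[] // _; rewrite ?perm_refl //.
by rewrite (perm_catC [:: _] [:: _]) perm_refl.
Qed.

Lemma A2_g_chain (p q r : A2gen n) b i : (i.+2 < n) -> gkey p = (i, b) ->
  gkey q = (i.+1, b) -> gkey r = (i.+2, b) -> A2_g p q r = 4.
Proof.
move=> lin pk qk rk; rewrite /A2_g pk qk rk.
(* Every pattern with exponent 3 contains both families, whereas a chain contains only one. *)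
have -> : [exists k : 'I_n, (k.+1 < n) &&
        [|| perm_eq [:: (i, b); (i.+1, b); (i.+2, b)] [:: (val k, false); (k.+1, false);
          (val k, true)],
            perm_eq [:: (i, b); (i.+1, b); (i.+2, b)] [:: (val k, false); (k.+1, false);
              (k.+1, true)],
            perm_eq [:: (i, b); (i.+1, b); (i.+2, b)] [:: (val k, false); (val k, true);
              (k.+1, true)] |
            perm_eq [:: (i, b); (i.+1, b); (i.+2, b)] [:: (k.+1, false); (val k, true);
              (k.+1, true)]]] = false.
  apply/existsP => -[k /andP[_ /or4P[]]] /(perm_all (fun x => x.2 == b));
  by rewrite /= !eqxx; case: b {pk qk rk}.
have lin' : i < n by lia.
case: existsP => // -[]; exists (Ordinal lin'); apply/andP; split=> //.
by apply/orP; case: b {pk qk rk}; [right|left]; exact: perm_refl.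
Qed.

Lemma A2_g_lo (p q r : A2gen n) b i : (i.+1 < n) -> gkey p = (i, b) ->
  gkey q = (i.+1, b) -> gkey r = (i, ~~ b) -> A2_g p q r = 3.
Proof.
move=> lin pk qk rk; rewrite /A2_g pk qk rk; have lin' : i < n by lia.
case: existsP => // -[]; exists (Ordinal lin'); apply/andP; split=> //.
apply/or4P; case: b {pk qk rk}; last by constructor 1; exact: perm_refl.
by constructor 3; rewrite (perm_catC [:: _; _] [:: _]); exact: perm_refl.
Qed.

Lemma A2_g_hi (p q r : A2gen n) b i : (i.+1 < n) -> gkey p = (i, b) ->
  gkey q = (i.+1, b) -> gkey r = (i.+1, ~~ b) -> A2_g p q r = 3.
Proof.
move=> lin pk qk rk; rewrite /A2_g pk qk rk; have lin' : i < n by lia.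
case: existsP => // -[]; exists (Ordinal lin'); apply/andP; split=> //.
apply/or4P; case: b {pk qk rk}; last by constructor 2; exact: perm_refl.
by constructor 4; rewrite (perm_catC [:: _; _] [:: _]); exact: perm_refl.
Qed.

Variables (G : groupType) (x : bool -> nat -> G).
Local Open Scope group_scope.
Let xk (k : nat * bool) := x k.2 k.1.

(** [coxeter_rels] fixes an order for each pair or triple, while relators occur in every order;
    [pow_rot] and [pow_perm3] bridge the gap. *)
Lemma relators_hold : coxeter_rels active x ->
  forall r, @cox_rel C r -> word_eval (fun p => xk (ckey p)) r = 1.
Proof.
case=> sq far opp same adj chain lo hi r.
have sqk k : active k.2 k.1 -> xk k ^+ 2 = 1 by apply: sq.
have act3 p q s (L : seq (nat * bool)) : perm_eq [:: ckey p; ckey q; ckey s] L ->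
    all (fun k => active k.2 k.1) L.
  by move/perm_all <-; rewrite /= !ckey_active.
case=> [[p ->]|[[p [q [pq ->]]]|[p [q [s [_ ->]]]]]].
- by rewrite /= mulg1 -expg2; apply/sqk/ckey_active.
- rewrite word_eval_pow /= mulg1 A2_fE.
  have := ckey_inj (x1 := p) (x2 := q); move: (ckey_active p) (ckey_active q).
  rewrite /ckey /gkey /=; move: (val (val p).1) (val p).2 (val (val q).1) (val q).2.
  move=> i b j c Ai Aj kpq; rewrite /xk /=.
  case: (eqVneq b c) => [bc|bc] /=.
    rewrite -bc in Aj kpq *.
    case: (eqVneq j i.+1) => [ji|ji1] /=.
      by rewrite ji in Aj *; apply: adj.
    case: (eqVneq i j.+1) => [ij|ij1] /=.
      by rewrite ij in Ai *; apply: pow_rot; apply: adj.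
    have [ij|ij|ij] := ltngtP i j.
    - by apply: far => //; lia.
    - by apply: pow_rot; apply: far => //; lia.
    by case/eqP: pq; apply: kpq; rewrite ij.
  have cb : c = ~~ b by case: b c bc {Ai Aj kpq} => -[].
  rewrite cb in Aj *; case: (eqVneq i j) => [ij|ij].
    by rewrite -ij; apply: same; rewrite // ij.
  exact: opp.
rewrite word_eval_pow [cox_g _ _ _]/(A2_g (val p) (val q) (val s)) /A2_g.
rewrite -/(ckey p) -/(ckey q) -/(ckey s).
have -> : word_eval (fun p => xk (ckey p)) [:: (p, true); (q, true); (s, true)] =
          xk (ckey p) * xk (ckey q) * xk (ckey s) by rewrite /= mulg1 mulgA.
case: existsP => [[i /andP[_ H]]|_]; last case: existsP => [[i /andP[_ H]]|//].
  case/or4P: H => K; have /and4P[A1 A2 A3 _] := act3 _ _ _ _ K;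
  apply: (pow_perm3 _ _ _ K); try exact: sqk; rewrite /xk /=.
  - exact: (lo false).
  - exact: (hi false).
  (* In the last two patterns the letter of the family [false] comes first; a rotation moves it to
     the end. *)
  - by rewrite -mulgA; apply: pow_rot; apply: (lo true).
  by rewrite -mulgA; apply: pow_rot; apply: (hi true).
case/orP: H => K; have /and4P[A1 A2 A3 _] := act3 _ _ _ _ K;
apply: (pow_perm3 _ _ _ K); try exact: sqk; rewrite /xk /=.
  exact: (chain false).
exact: (chain true).
Qed.

(** The converse, for the presented group: [psi] is defined on the restricted generators only,
    whereas [x] is a total function that extends it. *)
Lemma rels_of_relators (psi : cox_X C -> G) : psi =1 (fun p => xk (ckey p)) ->
  (forall r, @cox_rel C r -> word_eval psi r = 1) -> coxeter_rels active x.
Proof.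
move=> psiE psiR.
have H1 p : psi p ^+ 2 = 1.
  by rewrite -[RHS](psiR [:: (p, true); (p, true)]) /= ?mulg1 //; left; exists p.
have H2 p q : p != q -> (psi p * psi q) ^+ A2_f (val p) (val q) = 1.
  move=> pq; rewrite -[RHS](psiR (flatten (nseq (A2_f (val p) (val q)) [:: (p, true); (q, true)]))).
    by rewrite word_eval_pow /= mulg1.
  by right; left; exists p, q.
have H3 p q r : p != q -> q != r -> p != r ->
    (psi p * psi q * psi r) ^+ A2_g (val p) (val q) (val r) = 1.
  move=> pq qr pr; rewrite -[RHS](psiR (flatten (nseq (A2_g (val p) (val q) (val r))
    [:: (p, true); (q, true); (r, true)]))).
    by rewrite word_eval_pow /= mulg1 mulgA.
  by right; right; exists p, q, r.
have neq p q : ckey p <> ckey q -> p != q by move=> pq; apply/eqP => E; apply: pq; rewrite E.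
have E p b i : ckey p = (i, b) -> psi p = x b i by move=> pE; rewrite psiE /xk pE.
have fE p q b c i j : ckey p = (i, b) -> ckey q = (j, c) -> A2_f (val p) (val q) =
    (if (b == c) && ((j == i.+1) || (i == j.+1)) then 4
     else if (b != c) && (i == j) then 3 else 2)%N.
  by rewrite A2_fE => -[<- <-] [<- <-].
have act_lt b i : active b i -> (i < n)%N by case/andP.
split=> b i.
- by move=> /ckey_ex[p /E <-].
- move=> j /ckey_ex[p pk] /ckey_ex[q qk] ij; rewrite -(E _ _ _ pk) -(E _ _ _ qk).
  have pq : p != q by apply: neq; rewrite pk qk => -[]; lia.
  rewrite -[RHS](H2 _ _ pq) (fE _ _ _ _ _ _ pk qk) eqxx /=.
  by have [-> ->] : (j == i.+1) = false /\ (i == j.+1) = false by split; apply/eqP; lia.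
- move=> j /ckey_ex[p pk] /ckey_ex[q qk] ij; rewrite -(E _ _ _ pk) -(E _ _ _ qk).
  have pq : p != q by apply: neq; rewrite pk qk => -[ij']; rewrite ij' eqxx in ij.
  rewrite -[RHS](H2 _ _ pq) (fE _ _ _ _ _ _ pk qk) (negbTE ij).
  by case: (b).
- move=> /ckey_ex[p pk] /ckey_ex[q qk]; rewrite -(E _ _ _ pk) -(E _ _ _ qk).
  have pq : p != q by apply: neq; rewrite pk qk; case: (b).
  by rewrite -[RHS](H2 _ _ pq) (fE _ _ _ _ _ _ pk qk) eqxx; case: (b).
- move=> /ckey_ex[p pk] /ckey_ex[q qk]; rewrite -(E _ _ _ pk) -(E _ _ _ qk).
  have pq : p != q by apply: neq; rewrite pk qk => -[]; lia.
  by rewrite -[RHS](H2 _ _ pq) (fE _ _ _ _ _ _ pk qk) !eqxx.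
- move=> /ckey_ex[p pk] /ckey_ex[q qk] Ar; have := ckey_ex Ar => -[r rk].
  rewrite -(E _ _ _ pk) -(E _ _ _ qk) -(E _ _ _ rk).
  rewrite -[RHS](H3 p q r) ?(A2_g_chain (act_lt _ _ Ar) pk qk rk) //;
  by apply: neq; rewrite ?pk ?qk ?rk => -[]; lia.
- move=> /ckey_ex[p pk] Aq /ckey_ex[r rk]; have := ckey_ex Aq => -[q qk].
  rewrite -(E _ _ _ pk) -(E _ _ _ qk) -(E _ _ _ rk).
  rewrite -[RHS](H3 p q r) ?(A2_g_lo (act_lt _ _ Aq) pk qk rk) //;
  by apply: neq; rewrite ?pk ?qk ?rk => -[]; try lia; case: (b).
move=> /ckey_ex[p pk] Aq /ckey_ex[r rk]; have := ckey_ex Aq => -[q qk].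
rewrite -(E _ _ _ pk) -(E _ _ _ qk) -(E _ _ _ rk).
rewrite -[RHS](H3 p q r) ?(A2_g_hi (act_lt _ _ Aq) pk qk rk) //;
by apply: neq; rewrite ?pk ?qk ?rk => -[]; try lia; case: (b).
Qed.

End Relators.

(** * Parabolic subgroups as incidence groups *)

Section Parabolic.
Local Open Scope ring_scope.
Variable n : nat.
Implicit Types (lam mu : seq nat) (A : 'M['F_2]_n.+1).

(** Block triangularity as a condition on steps: the step between [t] and t+1 crosses a block
    boundary when t+1 is a stopover. *)
Definition lower_ok lam A := forall i j, A i j != 0 ->
  forall t, (j <= t < i)%N -> t.+1 \notin stopovers lam.

Lemma blk_leq lam i j : (i <= j)%N -> (blk lam i <= blk lam j)%N.
Proof. by move=> ij; apply: sub_count => s /= si; apply: leq_trans si ij. Qed.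

Lemma blk_count lam i j : (j <= i)%N ->
  blk lam i = (blk lam j + count (fun s => (j < s)%N && (s <= i)%N) (stopovers lam))%N.
Proof.
move=> ji; rewrite /blk; elim: (stopovers lam) => //= s l ->.
by case: (leqP s i) => si; case: (ltnP j s) => js /=; lia.
Qed.

Lemma blk_ltP lam i j : reflect (exists2 t, (j <= t < i)%N & t.+1 \in stopovers lam)
  (blk lam j < blk lam i)%N.
Proof.
have [ji|ij] := leqP j i; last first.
  rewrite ltnNge blk_leq 1?ltnW //; apply: ReflectF => -[t]; lia.
rewrite (blk_count lam ji) -[Y in (Y < _)%N]addn0 ltn_add2l -has_count.
apply: (iffP hasP) => [[s ss /andP[js si]]|[t tji st]].
  by exists s.-1; [lia | rewrite prednK //; lia].
by exists t.+1 => //; lia.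
Qed.

(** With all upward steps allowed, block triangular matrices form an incidence algebra, so
    [inc_groupV] shows that inverses stay block triangular. *)
Lemma lower_okP lam A : incid (fun b t => b || (t.+1 \notin stopovers lam)) n A <->
  lower_ok lam A.
Proof.
split=> [iA i j Aij t tji|lA i j Aij].
  by have [_ /(_ t tji)[]] := iA i j Aij.
split=> t tij; first by split=> //; have := ltn_ord j; lia.
by split; [exact: lA Aij _ tij | have := ltn_ord i; lia].
Qed.

Lemma sum_window (F : 'I_n.+1 -> 'F_2) s m : (s + m <= n.+1)%N ->
  (forall j : 'I_n.+1, (j < s)%N -> F j = 0) ->
  (forall j : 'I_n.+1, (s + m <= j)%N -> F j = 0) ->
  \sum_j F j = \sum_(j < m) F (inord (s + j)).
Proof.
move=> smn F1 F2.
have -> : \sum_j F j = \sum_(0 <= j < n.+1) F (inord j).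
  by rewrite big_mkord; apply: eq_bigr => j _; rewrite inord_val.
rewrite (@big_cat_nat _ _ _ s) //=; last by lia.
rewrite (@big_cat_nat _ _ _ (s + m) s) //=; last by lia.
rewrite big_nat big1 ?add0r; last first.
  by move=> j jl; apply: F1; rewrite inordK; lia.
rewrite addrC big_nat big1 ?add0r; last first.
  by move=> j jl; apply: F2; rewrite inordK; lia.
rewrite -{1}[s]add0n big_addn addKn big_mkord.
by apply: eq_bigr => j _; rewrite addnC.
Qed.

Lemma stopovers_mem lam k : (0 < k < size lam)%N -> sumn (take k lam) \in stopovers lam.
Proof. by move=> kl; apply: map_f; rewrite mem_iota; lia. Qed.

(** Conversely, if A is block triangular, then so is its inverse, and corresponding diagonal blocks
    of the two are inverse to each other. *)
Lemma mem_Pblock lam (A : GL2 n) : decomposition n.+1 lam ->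
  A \in Pblock n lam <-> lower_ok lam (GLval A).
Proof.
move=> /andP[_ /eqP sl]; rewrite inE; split=> [/andP[/forallP H _] i j Aij t tji|lA].
  apply: contraNN Aij => st; move: (H i) => /forallP/(_ j)/implyP; apply.
  by apply/blk_ltP; exists t.
apply/andP; split.
  apply/forallP => i; apply/forallP => j; apply/implyP => /blk_ltP[t tji st].
  by apply: contraTT st => Aij; exact: lA Aij _ tji.
apply/forallP => k; set m := nth 0%N lam k; set s := sumn (take k lam).
have skm : sumn (take k.+1 lam) = (s + m)%N.
  by rewrite (take_nth 0%N) // sumn_rcons.
have smn : (s + m <= n.+1)%N.
  by have := sumn_cat (take k.+1 lam) (drop k.+1 lam); rewrite cat_take_drop skm sl; lia.
have uA : GLval A \in unitmx by exact: GL_unit.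
have PA : inc_group (fun b t => b || (t.+1 \notin stopovers lam)) n (GLval A).
  by split; [exact: uA | exact: (lower_okP lam (GLval A)).2].
have lA' : lower_ok lam (invmx (GLval A)).
  by apply: (lower_okP lam (invmx (GLval A))).1; case: (inc_groupV PA).
have vk (i : 'I_m) : (inord (s + i) : 'I_n.+1) = (s + i)%N :> nat.
  by rewrite inordK //; have := ltn_ord i; lia.
suff: (\matrix_(i < m, j < m) GLval A (inord (s + i)) (inord (s + j))) *m
      (\matrix_(i < m, j < m) invmx (GLval A) (inord (s + i)) (inord (s + j))) = 1%:M.
  by case/mulmx1_unit.
apply/matrixP => i l; rewrite !mxE.
have : (GLval A *m invmx (GLval A)) (inord (s + i)) (inord (s + l)) = (i == l)%:R.
  rewrite mulmxV // mxE; congr (_ %:R); congr nat_of_bool.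
  apply/eqP/eqP => [/(congr1 val)|-> //].
  by rewrite /= !vk => /addnI /val_inj.
(* The sum over all columns shrinks to the block: A vanishes to its left, and the inverse of A
   vanishes below it. *)
rewrite mxE => <-; rewrite (sum_window smn).
- by apply: eq_bigr => j _; rewrite !mxE.
- move=> j js; case: (eqVneq (GLval A (inord (s + i)) j) 0) => [->|Aij]; first by rewrite mul0r.
  have k0 : (0 < k)%N by case: (posnP k) js => //; rewrite /s => ->; rewrite take0.
  have st : s.-1.+1 \in stopovers lam.
    by rewrite prednK; [apply: stopovers_mem; rewrite k0 ltn_ord | lia].
  suff: s.-1.+1 \notin stopovers lam by rewrite st.
  by apply: (lA _ _ Aij); rewrite vk; lia.
move=> j js; case: (eqVneq (invmx (GLval A) j (inord (s + l))) 0) => [->|Ajl].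
  by rewrite mulr0.
(* An index beyond the block exists, so the block is not the last and its end is a stopover. *)
have kl : (k.+1 < size lam)%N.
  rewrite ltnNge; apply/negP => kl; have := ltn_ord j.
  by have := skm; rewrite (take_oversize kl) sl; lia.
have st : (s + m).-1.+1 \in stopovers lam.
  by rewrite prednK; [rewrite -skm; apply: stopovers_mem | have := ltn_ord l; lia].
suff: (s + m).-1.+1 \notin stopovers lam by rewrite st.
by apply: (lA' _ _ Ajl); rewrite vk; have := ltn_ord l; lia.
Qed.

Lemma mem_Pblock_t mu (A : GL2 n) : decomposition n.+1 mu ->
  A \in Pblock_t n mu <-> lower_ok mu (GLval A)^T.
Proof.
move=> dmu; rewrite inE; split=> [/exists_inP[B /(mem_Pblock _ dmu) lB /eqP ->]|lA].
  by rewrite trmxK.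
have uAT : (GLval A)^T \is a GRing.unit by have := GL_unit A; rewrite -unitmx_tr.
apply/exists_inP; exists (FinRing.unit 'M['F_2]_n.+1 uAT); last by rewrite /= trmxK.
exact/(mem_Pblock _ dmu).
Qed.

Lemma mem_Plm lam mu (A : GL2 n) : decomposition n.+1 lam -> decomposition n.+1 mu ->
  A \in Plm n lam mu <-> inc_group (active n lam mu) n (GLval A).
Proof.
move=> dlam dmu; rewrite inE; split.
  move=> /andP[/(mem_Pblock _ dlam) lA /(mem_Pblock_t _ dmu) lAT].
  split; first exact: GL_unit.
  move=> i j Aij; split=> t tij.
    have tn : (t < n)%N by have := ltn_ord j; lia.
    by split=> //; rewrite /active tn; apply: (lAT j i) tij; rewrite mxE.
  have tn : (t < n)%N by have := ltn_ord i; lia.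
  by split=> //; rewrite /active tn; apply: lA Aij _ tij.
move=> [_ iA]; apply/andP; split.
  apply/(mem_Pblock _ dlam) => i j /iA[_ Aij] t tij.
  by have [/andP[]] := Aij t tij.
apply/(mem_Pblock_t _ dmu) => i j; rewrite mxE => /iA[Aij _] t tij.
by have [/andP[]] := Aij t tij.
Qed.

End Parabolic.

(** * The isomorphism *)

Lemma coxeter_rels_sub (G : groupType) (S T : bool -> nat -> bool) (x : bool -> nat -> G) :
  (forall b i, S b i -> T b i) -> coxeter_rels T x -> coxeter_rels S x.
Proof.
move=> ST [sq far opp same adj chain lo hi]; split=> b i.
- by move=> /ST; apply: sq.
- by move=> j /ST ? /ST; apply: far.
- by move=> j /ST ? /ST; apply: opp.
- by move=> /ST ? /ST; apply: same.
- by move=> /ST ? /ST; apply: adj.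
- by move=> /ST ? /ST ? /ST; apply: chain.
- by move=> /ST ? /ST ? /ST; apply: lo.
by move=> /ST ? /ST ? /ST; apply: hi.
Qed.

Theorem theorem1 (n : nat) (lam mu : seq nat) :
  decomposition n.+1 lam -> decomposition n.+1 mu ->
  cox_group_isom (cox_restr (A2 n) (S_lm n lam mu)) (Plm n lam mu).
Proof.
move=> dlam dmu; set C := cox_restr _ _; set S := active n lam mu.
pose psi (p : cox_X C) : GL2 n := gen_GL n (ckey p).2 (ckey p).1.
have psiP p : inc_group S n (GLval (psi p)).
  by rewrite gen_GLE; have Ap := ckey_active p; have /andP[lin _] := Ap; apply: inc_group_gen_mx.
have inc_groupV' (g : GL2 n) : inc_group S n (GLval g) -> inc_group S n (GLval g^-1%g)
  by rewrite GL_VxE; exact: inc_groupV.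
have evalP w : inc_group S n (GLval (eval_word psi w)).
  elim: w => [|[p b] w IH]; first exact: inc_group1.
  rewrite [eval_word _ _]/= GL_MxE; apply: inc_groupM; last exact: IH.
  by case: b; [exact: psiP | exact: (inc_groupV' (psi p))].
have XgS : coxeter_rels S (gen_GL n).
  by apply: coxeter_rels_sub (gen_GL_rels n) => b i /andP[].
exists psi; split.
- by move=> w; apply/(mem_Plm _ dlam dmu).
- move=> h /(mem_Plm _ dlam dmu) Ph.
  (* Surjectivity: the evaluations of words are closed under products and contain the generators. *)
  suff [w wh] : exists w, GLval (eval_word psi w) = GLval h.
    by exists w; apply: val_inj.
  move: (GLval h) Ph; apply: inc_group_gen => //; first by exists [::].
    move=> A B [u <-] [v <-]; exists (u ++ v).
    by rewrite -GL_MxE; congr GLval; exact: (word_eval_cat psi).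
  move=> b i _ /ckey_ex[p pk]; exists [:: (p, true)].
  by rewrite -gen_GLE; congr GLval; rewrite [LHS]mulg1 /psi pk.
move=> u v; split; last first.
  by apply: word_eval_pres; exact: relators_hold XgS.
pose R := @cox_rel C.
(* The generators of the presented group as a total family, with default value 1 outside S. *)
pose x b i : pres_group R := match pselect (exists p : cox_X C, ckey p = (i, b)) with
  | left h => pres_gen R (projT1 (cid h)) | right _ => 1%g end.
have xE p : pres_gen R p = x (ckey p).2 (ckey p).1.
  rewrite /x; case: pselect => [h|[]]; last by exists p; case: (ckey p).
  case: (cid h) => q qk; congr (pres_gen _ _); apply: ckey_inj.
  by rewrite qk; case: (ckey p).
have relx : coxeter_rels S x.
  apply: (rels_of_relators (psi := pres_gen R)); first exact: xE.
  move=> r Rr; rewrite word_eval_gen; apply/word_class_eq.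
  by have := pe_rel [::] [::] Rr; rewrite cats0.
have [phi [phiM phiX]] := incidence_universal relx (leqnn n).
(* Injectivity: the class of a word is recovered from its matrix through [phi]. *)
have phiE w : word_class R w = phi (GLval (eval_word psi w)).
  rewrite -word_eval_gen; elim: w => [|[p b] w IH]; first by rewrite /= (hom_mx1 phiM).
  rewrite [eval_word _ _]/= GL_MxE phiM //; last first.
    by case: b; [exact: psiP | exact: (inc_groupV' (psi p))].
  rewrite /= IH; congr (_ * _)%g.
  have pE : phi (GLval (psi p)) = pres_gen R p.
    have Ap := ckey_active p; have /andP[lin _] := Ap.
    by rewrite gen_GLE (phiX _ _ lin Ap) xE.
  (* Generators are involutions on both sides, so inverse letters reduce to positive ones. *)
  have psiV : ((psi p)^-1 = psi p)%g by apply: inv2; exact: gen_GL_sq.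
  have genV : ((pres_gen R p)^-1 = pres_gen R p)%g.
    by apply: inv2; rewrite xE; apply: (rel_sq relx); exact: ckey_active.
  by case: b; rewrite ?psiV ?genV pE.
by move=> uv; apply/word_class_eq; rewrite !phiE uv.
Qed.
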